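(* Let $N\ge 2$, let $k$ be an integer with $1\le k\le N-1$, and let $B_\rho\subset\mathbb{R}^N$ be the ball of radius $\rho>0$ centered at $0$. Let $\mu(\Delta)$ be the principal eigenvalue of the Laplacian with Dirichlet boundary conditions in the ball of radius $\rho$ centered at $0$ in $\mathbb{R}^k$, and let $v(|\cdot|)$ be a corresponding positive radial eigenfunction, so that $v>0$ on $[0,\rho)$, $v''(r)+\frac{k-1}{r}v'(r)+\mu(\Delta)v(r)=0$ for $r\in(0,\rho)$, $v'(0)=0$ and $v(\rho)=0$. Then $$\mu_k^+(B_\rho)=\mu(\Delta),$$ and $u(x)=v(|x|)$, $x\in B_\rho$, is a corresponding principal eigenfunction: $u>0$ in $B_\rho$, $u=0$ on $\partial B_\rho$ and $\mathcal{P}^+_k(D^2u)+\mu_k^+(B_\rho)\,u=0$ in $B_\rho$.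
   Context: For a symmetric real $N\times N$ matrix $X$ with ordered eigenvalues $\lambda_1(X)\le\dots\le\lambda_N(X)$, $\mathcal{P}^+_k(X)=\sum_{i=1}^k\lambda_{N+1-i}(X)$ is the sum of the $k$ largest eigenvalues. For a bounded domain $\Omega\subset\mathbb{R}^N$, $$\mu_k^+(\Omega)=\sup\{\mu\in\mathbb{R} : \exists\, \phi>0 \text{ in } \Omega,\ \mathcal{P}^+_k(D^2\phi)+\mu\phi\le 0 \text{ in }\Omega\},$$ where $\phi$ is lower semicontinuous and the inequality is understood in the viscosity sense. The principal eigenvalue $\mu(\Delta)$ is the number for which $\Delta\psi+\mu(\Delta)\psi=0$ has a positive solution $\psi$ vanishing on the boundary. *)

(* Defs.v *)
From mathcomp Require Export all_boot all_order all_algebra.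
From mathcomp Require Export all_classical all_reals all_analysis.
Export Order.TTheory GRing.Theory Num.Theory.
Export numFieldNormedType.Exports.

Set Implicit Arguments.
Unset Strict Implicit.
Unset Printing Implicit Defensive.

Local Open Scope classical_set_scope.
Local Open Scope ring_scope.

Section Euclidean.
Context {R : realType} {N : nat}.

(* The library's norm on ['rV[R]_N] is the sup norm: it gives the topology,
   but Euclidean balls need the Euclidean norm. *)
Definition enorm (x : 'rV[R]_N) : R := Num.sqrt (\sum_(i < N) x 0 i ^+ 2).

Definition eball (rho : R) : set 'rV[R]_N := [set x | enorm x < rho].

Definition boundary (Omega : set 'rV[R]_N) : set 'rV[R]_N :=
  closure Omega `\` interior Omega.

Definition partial (i : 'I_N) (f : 'rV[R]_N -> R) : 'rV[R]_N -> R :=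
  fun x => 'D_(delta_mx 0 i) f x.

(* [f] is C^2 in the open set [Omega]; existence is required separately, as
   ['D_v] is a total function with a junk value. *)
Definition C2_on (Omega : set 'rV[R]_N) (f : 'rV[R]_N -> R) : Prop :=
  forall x, Omega x ->
    {for x, continuous f} /\
    forall i : 'I_N,
      [/\ derivable f x (delta_mx 0 i),
          {for x, continuous (partial i f)} &
          forall j : 'I_N, derivable (partial i f) x (delta_mx 0 j) /\
                           {for x, continuous (partial j (partial i f))}].

Definition hessian (f : 'rV[R]_N -> R) (x : 'rV[R]_N) : 'M[R]_N :=
  \matrix_(i, j) partial j (partial i f) x.

Definition laplacian (f : 'rV[R]_N -> R) (x : 'rV[R]_N) : R :=
  \sum_(i < N) partial i (partial i f) x.

Definition positive_in (Omega : set 'rV[R]_N) (f : 'rV[R]_N -> R) : Prop :=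
  forall x, Omega x -> 0 < f x.

(* The boundary values are attained continuously. *)
Definition vanishes_on_boundary (Omega : set 'rV[R]_N) (f : 'rV[R]_N -> R) :
    Prop :=
  {within closure Omega, continuous f} /\
  forall x, boundary Omega x -> f x = 0.

Definition laplace_principal_eigenfunction (Omega : set 'rV[R]_N) (mu : R)
    (psi : 'rV[R]_N -> R) : Prop :=
  [/\ C2_on Omega psi, positive_in Omega psi, vanishes_on_boundary Omega psi &
      forall x, Omega x -> laplacian psi x + mu * psi x = 0].

Definition laplace_principal_eigenvalue (Omega : set 'rV[R]_N) (mu : R) :
    Prop :=
  exists psi, laplace_principal_eigenfunction Omega mu psi.

(* Eigenvalues in nondecreasing order, with multiplicity. Such a sequence
   exists and is unique when [X] is symmetric; [[::]] is a junk value for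
   matrices whose characteristic polynomial does not split over [R]. *)
Definition eigenvalues (X : 'M[R]_N) : seq R :=
  xget [::] [set s : seq R | sorted <=%R s /\
                             char_poly X = \prod_(a <- s) ('X - a%:P)].

(* Indexed from 1. *)
Definition lambda (X : 'M[R]_N) (i : nat) : R := (eigenvalues X)`_(i.-1).

Definition Pplus (k : nat) (X : 'M[R]_N) : R :=
  \sum_(1 <= i < k.+1) lambda X (N.+1 - i).

(* Points outside [Omega] are isolated in [subspace Omega], so these only
   constrain [f] in [Omega]. *)
Definition lsc_in (Omega : set 'rV[R]_N) (f : 'rV[R]_N -> R) : Prop :=
  lower_semicontinuous (fun x : subspace Omega => (f x)%:E).

Definition usc_in (Omega : set 'rV[R]_N) (f : 'rV[R]_N -> R) : Prop :=
  lsc_in Omega (fun x => - f x).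

(* [F (D^2 u) + mu u <= 0] in the open set [Omega], in the viscosity sense. *)
Definition viscosity_supersolution (F : 'M[R]_N -> R) (mu : R)
    (Omega : set 'rV[R]_N) (u : 'rV[R]_N -> R) : Prop :=
  lsc_in Omega u /\
  forall (psi : 'rV[R]_N -> R) (x : 'rV[R]_N),
    C2_on Omega psi -> Omega x ->
    (\forall y \near x, u x - psi x <= u y - psi y) ->
    F (hessian psi x) + mu * u x <= 0.

(* [F (D^2 u) + mu u >= 0] in the open set [Omega], in the viscosity sense. *)
Definition viscosity_subsolution (F : 'M[R]_N -> R) (mu : R)
    (Omega : set 'rV[R]_N) (u : 'rV[R]_N -> R) : Prop :=
  usc_in Omega u /\
  forall (psi : 'rV[R]_N -> R) (x : 'rV[R]_N),
    C2_on Omega psi -> Omega x ->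
    (\forall y \near x, u y - psi y <= u x - psi x) ->
    0 <= F (hessian psi x) + mu * u x.

Definition viscosity_solution (F : 'M[R]_N -> R) (mu : R)
    (Omega : set 'rV[R]_N) (u : 'rV[R]_N -> R) : Prop :=
  viscosity_subsolution F mu Omega u /\ viscosity_supersolution F mu Omega u.

(* The supremum is taken in the extended reals: it may be infinite for a
   general [Omega], and the real-valued [sup] would then be a junk value. *)
Definition mu_plus (k : nat) (Omega : set 'rV[R]_N) : \bar R :=
  ereal_sup [set mu%:E | mu in
    [set mu : R | exists phi, positive_in Omega phi /\
                  viscosity_supersolution (Pplus k) mu Omega phi]].

End Euclidean.

(* Main.v *)
(* Writing t for the Laplace eigenvalue on the k-ball, the ODE gives
   r^(k-1) v' = - t \int_0^r s^(k-1) v(s) ds. Hence t > 0, v is nonincreasing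
   and v'/r <= v'', so the k largest eigenvalues of the Hessian of u = v(|x|)
   are v'' and k - 1 copies of v'/r, whose sum is - t v. Second-order bounds of
   v(|x|) by polynomials in |x|^2 replace its Hessian, also at the origin, and
   Ky Fan's variational formula for Pplus then shows that u is a viscosity
   solution. If some positive phi is a supersolution with m > t, the dilation
   v(s |x|) with s > 1 and s^2 t < m lives on a compactly contained ball; where
   its quotient by phi is maximal it touches phi from below up to a factor, and
   the inequality for phi there gives m <= s^2 t, a contradiction. *)

Require Import Defs.
From mathcomp Require Import perm ring lra zify.

Set Implicit Arguments.
Unset Strict Implicit.
Unset Printing Implicit Defensive.

Local Open Scope classical_set_scope.
Local Open Scope ring_scope.

(** * Spectral theorem *)

Section LinearAlgebra.
Variable R : realType.

(** The equation is singular at the origin and [v] is known to be twice differentiable only on (0,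
    rho), so [u] itself cannot serve as a C^2 test function there; a quartic that is radial in y is
    smooth everywhere. Near each radius the profile is bounded by such quartics up to an arbitrarily
    small [eta], which the strict inequality in each later contradiction absorbs. The two halves of
    the viscosity property are not symmetric. A lower bound on [Pplus] only needs one good frame,
    and a frame containing the direction of x gives the full value whatever the sign of the radial
    coefficient. An upper bound must hold for the extremal frame, about which only Bessel's
    inequality is known; this requires a nonnegative radial coefficient, and that is where v'/r <=
    v'' enters. The upper bound on the principal eigenvalue rests on quartics below the profile
    alone. The integral of the flux identity is never formed: a function that tends to 0 at 0+ and
    has a nonpositive derivative is nonpositive, and this is applied, up to sign, to r^(k-1) v' + c
    r^k / k for suitable constants c. *)

Definition dot n (x y : 'rV[R]_n) : R := (x *m y^T) 0 0.

Lemma dotE n (x y : 'rV[R]_n) : dot x y = \sum_i x 0 i * y 0 i.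
Proof. by rewrite /dot mxE; apply: eq_bigr => i _; rewrite mxE. Qed.

Lemma dotC n (x y : 'rV[R]_n) : dot x y = dot y x.
Proof. by rewrite !dotE; apply: eq_bigr => i _; rewrite mulrC. Qed.

Lemma dotDl n (x y z : 'rV[R]_n) : dot (x + y) z = dot x z + dot y z.
Proof. by rewrite /dot mulmxDl mxE. Qed.

Lemma dotZl n a (x z : 'rV[R]_n) : dot (a *: x) z = a * dot x z.
Proof. by rewrite /dot -scalemxAl mxE. Qed.

Lemma dotDr n (x y z : 'rV[R]_n) : dot z (x + y) = dot z x + dot z y.
Proof. by rewrite !(dotC z) dotDl. Qed.

Lemma dotZr n a (x z : 'rV[R]_n) : dot z (a *: x) = a * dot z x.
Proof. by rewrite !(dotC z) dotZl. Qed.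

Lemma dotNl n (x z : 'rV[R]_n) : dot (- x) z = - dot x z.
Proof. by rewrite -scaleN1r dotZl mulN1r. Qed.

Lemma dotNr n (x z : 'rV[R]_n) : dot z (- x) = - dot z x.
Proof. by rewrite !(dotC z) dotNl. Qed.

Lemma dot0l n (z : 'rV[R]_n) : dot 0 z = 0.
Proof. by rewrite -(scale0r 0) dotZl mul0r. Qed.

Lemma dot_ge0 n (x : 'rV[R]_n) : 0 <= dot x x.
Proof. by rewrite dotE; apply: sumr_ge0 => i _; rewrite -expr2 sqr_ge0. Qed.

Lemma dot_eq0 n (x : 'rV[R]_n) : dot x x = 0 -> x = 0.
Proof.
rewrite dotE => /eqP; rewrite psumr_eq0 => [/allP x0|i _]; last first.
  by rewrite -expr2 sqr_ge0.
apply/rowP => i; rewrite mxE.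
by have := x0 i; rewrite mem_index_enum mulf_eq0 orbb => /(_ isT)/eqP.
Qed.

Lemma dot_delta n (x : 'rV[R]_n) i : dot x (delta_mx 0 i) = x 0 i.
Proof.
rewrite dotE (bigD1 i)//= big1 => [|j /negPf ji]; rewrite mxE !eqxx/= ?mulr1.
  by rewrite addr0.
by rewrite ji mulr0.
Qed.

Lemma dot_row m n (A : 'M[R]_(m, n)) (x : 'rV[R]_n) i :
  dot x (row i A) = (x *m A^T) 0 i.
Proof. by rewrite dotE mxE; apply: eq_bigr => j _; rewrite !mxE. Qed.

(** Householder reflection: for w = e - e0, the symmetric matrix 1 - (2 / |w|^2) w^T w exchanges the
    unit vectors e0 and e. *)
Lemma reflection_to n (e : 'rV[R]_n.+1) : dot e e = 1 ->
  exists2 Q : 'M[R]_n.+1, Q *m Q^T = 1%:M & row 0 Q = e.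
Proof.
move=> e1; pose e0 : 'rV[R]_n.+1 := delta_mx 0 0.
have e01 : dot e0 e0 = 1 by rewrite dot_delta mxE !eqxx.
have [->|ne] := eqVneq e e0.
  exists 1%:M; first by rewrite trmx1 mul1mx.
  by rewrite row1.
have [w wE] : {w : 'rV[R]_n.+1 | w = e - e0} by exists (e - e0).
have w0 : dot w w != 0.
  by apply: contra_neq ne => /dot_eq0 /eqP; rewrite wE subr_eq0 => /eqP.
(* Since e and e0 are unit vectors, the coefficient of w in the image of e0 becomes exactly 1. *)
have ww : dot w w = - (2 * dot e0 w).
  rewrite wE !(dotDl, dotDr, dotNl, dotNr) e1 e01 (dotC e); ring.
have [c cw] : {c | c * dot w w = 2} by exists (2 / dot w w); rewrite divfK.
pose Q : 'M[R]_n.+1 := 1%:M - c *: (w^T *m w).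
have QT : Q^T = Q by rewrite /Q linearB/= linearZ/= trmx_mul trmxK trmx1.
have wwM : w *m w^T = (dot w w)%:M by rewrite [LHS]mx11_scalar.
exists Q.
  rewrite QT /Q mulmxBl mul1mx mulmxBr mulmx1 -scalemxAl -scalemxAr.
  rewrite mulmxA -(mulmxA w^T) wwM mul_mx_scalar -scalemxAl !scalerA.
  by rewrite cw mulr_natr mulr2n scalerDl opprB addrK subrK.
rewrite rowE -/e0 /Q mulmxBr mulmx1 -scalemxAr mulmxA.
have -> : e0 *m w^T = (dot e0 w)%:M by rewrite [LHS]mx11_scalar.
rewrite mul_scalar_mx scalerA; have -> : c * dot e0 w = -1.
  by apply: (mulIf w0); rewrite mulN1r mulrAC cw ww opprK.
by rewrite scaleN1r opprK wE addrC subrK.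
Qed.

Lemma dot_mul_sym n (X : 'M[R]_n) (x y : 'rV[R]_n) : X^T = X ->
  dot (x *m X) y = dot (y *m X) x.
Proof. by move=> sX; rewrite dotC /dot trmx_mul sX mulmxA. Qed.

Lemma cont_add (T : topologicalType) (f g : T -> R) x : {for x, continuous f} ->
  {for x, continuous g} -> {for x, continuous (fun y => f y + g y)}.
Proof. by move=> cf cg; apply: cvgD. Qed.

Lemma cont_mul (T : topologicalType) (f g : T -> R) x : {for x, continuous f} ->
  {for x, continuous g} -> {for x, continuous (fun y => f y * g y)}.
Proof. by move=> cf cg; apply: cvgM. Qed.

Lemma cont_cst (T : topologicalType) (a : R) x : {for x, continuous (fun _ : T => a)}.
Proof. exact: cvg_cst. Qed.

Lemma cont_coord n i (x : 'rV[R]_n) : {for x, continuous (fun y : 'rV[R]_n => y 0 i)}.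
Proof. exact: coord_continuous. Qed.

Lemma cont_sum (T : topologicalType) (I : Type) (r : seq I) (F : I -> T -> R) x :
  (forall i, {for x, continuous (F i)}) ->
  {for x, continuous (fun x => \sum_(i <- r) F i x)}.
Proof.
by move=> cF; apply: cvg_big => [|i _]; [exact: add_continuous|exact: cF].
Qed.

Lemma quad_continuous n (X : 'M[R]_n) :
  continuous (fun x : 'rV[R]_n => dot (x *m X) x).
Proof.
rewrite (_ : (fun x => _) = fun x : 'rV[R]_n => \sum_i (\sum_j x 0 j * X j i) * x 0 i).
  move=> x; apply: cont_sum => i; apply: cont_mul; last exact: cont_coord.
  by apply: cont_sum => j; apply: cont_mul; [exact: cont_coord|exact: cont_cst].
by apply/funext => x; rewrite dotE; apply: eq_bigr => i _; rewrite mxE.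
Qed.

Lemma dot_self_continuous n : continuous (fun x : 'rV[R]_n => dot x x).
Proof.
rewrite (_ : (fun x => _) = fun x : 'rV[R]_n => dot (x *m 1%:M) x).
  exact: quad_continuous.
by apply/funext => x; rewrite mulmx1.
Qed.

Lemma sphere_compact n : compact [set x : 'rV[R]_n | dot x x = 1].
Proof.
apply: bounded_closed_compact.
  exists 1; split => // M M1 x /= x1; apply: le_trans (ltW M1).
  rewrite [leLHS]mx_normrE; apply/bigmax_leP; split => //= -[i j] _ /=.
  rewrite (ord1 i) -(@expr_le1 _ 2)// real_normK ?num_real// -x1 dotE (bigD1 j)//= -expr2.
  by rewrite lerDl; apply: sumr_ge0 => k _; rewrite -expr2 sqr_ge0.
apply: (@closed_comp _ _ (fun x : 'rV[R]_n => dot x x) [set y | y = 1]) => //.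
  by move=> x _; exact: dot_self_continuous.
Qed.

(** Moving from x in the direction y = x B changes the form by 2 t |y|^2 + O(t^2), which can stay
    nonnegative for small negative t only if y = 0. *)
Lemma psd_kernel n (B : 'M[R]_n) (x : 'rV[R]_n) : B^T = B ->
  (forall y : 'rV[R]_n, 0 <= dot (y *m B) y) -> dot (x *m B) x = 0 -> x *m B = 0.
Proof.
move=> sB B0 xB; apply: dot_eq0.
set y := x *m B; have Bt t : 0 <= 2 * t * dot y y + t ^+ 2 * dot (y *m B) y.
  have := B0 (x + t *: y).
  rewrite mulmxDl -scalemxAl !(dotDl, dotDr, dotZl, dotZr) xB.
  rewrite (dot_mul_sym y x sB) -/y => h; apply: le_trans h _. lra.
set q := dot (y *m B) y in Bt; set d := dot y y in Bt *.
have d0 : 0 <= d by exact: dot_ge0.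
have q0 : 0 <= q by exact: B0.
(* With d = s (q + 1) the inequality at t = -s reads -s^2 (q + 2) >= 0, hence s = 0. The summand 1
   keeps the denominator positive when q = 0. *)
have := Bt (- (d / (q + 1))) ; set s := d / (q + 1).
have sE : d = s * (q + 1) by rewrite /s divfK// gt_eqF// ltr_wpDl.
have s0 : 0 <= s by rewrite /s divr_ge0// addr_ge0.
rewrite sE; nra.
Qed.

(** A maximiser e of the quadratic form on the unit sphere, with maximum l, makes l - X positive
    semidefinite with vanishing form at e, so e lies in its kernel. *)
Lemma sym_eigenvector n (X : 'M[R]_n.+1) : X^T = X ->
  exists e l, dot e e = 1 /\ e *m X = l *: e.
Proof.
move=> sX; have [||e /[!inE]/= e1 emax] :=
  @EVT_max_rV R n.+1 (fun x => dot (x *m X) x) _ _ (@sphere_compact n.+1).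
- by exists (delta_mx 0 0); rewrite /= dot_delta mxE !eqxx.
- by apply: continuous_subspaceT; exact: quad_continuous.
exists e, (dot (e *m X) e); split=> //; set l := dot (e *m X) e.
suff : e *m (l%:M - X) = 0.
  by rewrite mulmxBr mul_mx_scalar => /eqP; rewrite subr_eq0 => /eqP.
have BE y : dot (y *m (l%:M - X)) y = l * dot y y - dot (y *m X) y.
  by rewrite mulmxBr mul_mx_scalar dotDl dotZl dotNl.
apply: psd_kernel.
- by rewrite linearB/= tr_scalar_mx sX.
- move=> y; rewrite BE subr_ge0.
  have [y0|y0] := eqVneq (dot y y) 0.
    by rewrite (dot_eq0 y0) mul0mx !dot0l mulr0.
  have yp : 0 < dot y y by rewrite lt_def y0 dot_ge0.
  have s2 : Num.sqrt (dot y y) ^+ 2 = dot y y by rewrite sqr_sqrtr// ltW.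
  have sp : 0 < Num.sqrt (dot y y) by rewrite sqrtr_gt0.
  pose z := (Num.sqrt (dot y y))^-1 *: y.
  have := emax z; rewrite inE /z /= -scalemxAl !dotZl !dotZr !mulrA -expr2 exprVn s2.
  rewrite mulVf// => /(_ erefl).
  by rewrite ler_pdivrMl// mulrC.
- by rewrite BE e1 mulr1 subrr.
Qed.

(** Induction on the size: a reflection carries an eigenvector to the first basis vector, which
    splits off a 1 x 1 block. The rows of [P] are the eigenvectors. *)
Lemma spectral_theorem n (X : 'M[R]_n) : X^T = X ->
  exists (P : 'M[R]_n) (d : 'rV[R]_n), P *m P^T = 1%:M /\ X = P^T *m diag_mx d *m P.
Proof.
elim: n X => [|n IH] X sX.
  by exists 1%:M, 0; rewrite trmx1 mulmx1; split => //; apply/matrixP => -[].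
have [e [l [e1 eX]]] := sym_eigenvector sX.
have [Q QQ Q0] := reflection_to e1.
have QtQ : Q^T *m Q = 1%:M by apply: mulmx1C.
have [Y YE] : {Y : 'M[R]_(1 + n) | Y = Q *m X *m Q^T} by exists (Q *m X *m Q^T).
have sY : Y^T = Y by rewrite YE !trmx_mul trmxK sX mulmxA.
have Y0 j : Y 0 j = l * (0 == j)%:R.
  have -> : Y 0 j = (row 0 (Q *m X *m Q^T)) 0 j by rewrite [RHS]mxE YE.
  rewrite !row_mul Q0 eX -scalemxAl mxE -Q0 -row_mul QQ !mxE.
  by [].
have l0 : lshift n (0 : 'I_1) = (0 : 'I_n.+1) by apply: val_inj.
(* The first row of [Y] is l e0, and by symmetry so is its first column. *)
have Yb : Y = block_mx l%:M 0 0 (drsubmx Y).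
  rewrite -[LHS]submxK; congr block_mx.
  - apply/matrixP => i j; rewrite !ord1 !mxE.
    by rewrite l0 Y0 ?mulr1//.
  - apply/matrixP => i j; rewrite !ord1 !mxE.
    by rewrite l0 Y0 ?mulr0//.
  - apply/matrixP => i j; rewrite !ord1 -sY !mxE.
    by rewrite l0 Y0 ?mulr0//.
have [|P [d [PP dE]]] := IH (drsubmx Y).
  by rewrite trmx_drsub sY.
pose B : 'M[R]_(1 + n) := block_mx 1%:M 0 0 P.
pose c : 'rV[R]_(1 + n) := row_mx l%:M d.
have BB : B *m B^T = 1%:M.
  rewrite tr_block_mx mulmx_block !trmx0 trmx1 !mulmx0 !mul0mx !addr0 !add0r mulmx1 PP.
  by rewrite -scalar_mx_block.
have YB : Y = B^T *m diag_mx c *m B.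
  rewrite Yb dE diag_mx_row tr_block_mx !trmx0 trmx1 !mulmx_block.
  rewrite !mulmx0 !mul0mx !mul1mx !mulmx1 !addr0 !add0r.
  by congr block_mx; rewrite ?mul0mx//; apply/matrixP => i j; rewrite !ord1 !mxE.
exists (B *m Q), c; split.
  by rewrite trmx_mul mulmxA -(mulmxA _ Q) QQ mulmx1.
by rewrite trmx_mul !mulmxA -2!(mulmxA Q^T) -YB YE !mulmxA QtQ mul1mx -mulmxA QtQ
  mulmx1.
Qed.

End LinearAlgebra.

(** * Ky Fan inequality *)

Section KyFan.
Variable R : realType.

Lemma char_poly_diag_conj n (P : 'M[R]_n) (d : 'rV[R]_n) : P *m P^T = 1%:M ->
  char_poly (P^T *m diag_mx d *m P) = \prod_j ('X - (d 0 j)%:P).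
Proof.
move=> PP; have PtP : P^T *m P = 1%:M by apply: mulmx1C.
pose p := map_mx (@polyC R) P.
have pp : p^T *m p = 1%:M by rewrite /p map_trmx -map_mxM PtP map_mx1.
transitivity (char_poly (diag_mx d)); last first.
  rewrite char_poly_trig ?diag_mx_is_trig//.
  by apply: eq_bigr => j _; rewrite mxE eqxx mulr1n.
rewrite /char_poly.
have -> : char_poly_mx (P^T *m diag_mx d *m P) = p^T *m char_poly_mx (diag_mx d) *m p.
  rewrite /char_poly_mx mulmxBr mulmxBl mul_mx_scalar -scalemxAl pp scalemx1.
  by rewrite !map_mxM /p map_trmx.
rewrite !det_mulmx mulrC mulrA -det_mulmx.
by rewrite (mulmx1C pp) det1 mul1r.
Qed.

(** The characteristic polynomial determines its roots with multiplicity, so the sorted list is a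
    permutation of any diagonalisation, and permuting the rows of [P] puts the diagonal in that
    order. *)
Lemma eigenvaluesP n (X : 'M[R]_n) : X^T = X ->
  exists P : 'M[R]_n, [/\ P *m P^T = 1%:M, sorted <=%R (eigenvalues X),
    size (eigenvalues X) = n &
    X = P^T *m diag_mx (\row_j (eigenvalues X)`_j) *m P].
Proof.
move=> /spectral_theorem[P [d [PP XE]]].
have := char_poly_diag_conj d PP; rewrite -XE => cX.
have cX' : char_poly X = \prod_(a <- [tuple d 0 j | j < n]) ('X - a%:P).
  by rewrite cX /= big_map big_enum.
(* The sorted diagonal satisfies the specification, so [eigenvalues X] is not the default value. *)
have [se pe] : [set s : seq R | sorted <=%R s /\
    char_poly X = \prod_(a <- s) ('X - a%:P)] (eigenvalues X).
  apply: (@xgetPex _ [::]); exists (sort <=%R [tuple d 0 j | j < n]).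
  split; first by apply: sort_sorted => x y; exact: le_total.
  by rewrite cX'; apply: perm_big; rewrite perm_sym perm_sort.
move: se pe; set s := eigenvalues X => se pe.
have : perm_eq s [tuple d 0 j | j < n] by apply: prod_XsubC_eq; rewrite -pe.
move=> /tuple_permP[g sg].
exists (row_perm g P); split => //.
- apply/matrixP => i j; have /matrixP/(_ (g i) (g j)) := PP.
  rewrite !mxE (inj_eq perm_inj) => <-.
  by apply: eq_bigr => l _; rewrite !mxE.
- by rewrite sg size_tuple.
- rewrite [LHS]XE; apply/matrixP => i j; rewrite !mxE.
  rewrite (reindex_inj (@perm_inj _ g)); apply: eq_bigr => l _.
  rewrite !mul_mx_diag !mxE; congr (_ * _ * _).
  by rewrite sg -tnth_nth !tnth_mktuple.
Qed.

(** [lambda] counts from 1 and the list from 0: the k largest eigenvalues sit at positions n - k to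
    n - 1. *)
Lemma PplusE n k (X : 'M[R]_n) : (k <= n)%N ->
  Pplus k X = \sum_(n - k <= j < n) (eigenvalues X)`_j.
Proof.
move=> kn; rewrite -[X in \sum_(X <= _ < _) _]add0n big_addn subKn//.
rewrite /Pplus /lambda big_add1/= big_nat_rev/= !big_nat.
by apply: eq_bigr => i ik; congr (_`_ _); lia.
Qed.

(** [y *m F] is the orthogonal projection of x onto the span of the frame, and the remainder has
    nonnegative square. *)
Lemma bessel n k (F : 'M[R]_(k, n)) (x : 'rV[R]_n) : F *m F^T = 1%:M ->
  \sum_i dot x (row i F) ^+ 2 <= dot x x.
Proof.
move=> FF; pose y := x *m F^T.
have -> : \sum_i dot x (row i F) ^+ 2 = dot y y.
  by rewrite dotE; apply: eq_bigr => i _; rewrite dot_row.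
have yx : dot (y *m F) x = dot y y by rewrite /dot -mulmxA /y trmx_mul trmxK.
have yy : dot (y *m F) (y *m F) = dot y y.
  by rewrite /dot trmx_mul mulmxA -(mulmxA y) FF mulmx1.
have := dot_ge0 (x - y *m F).
rewrite !(dotDl, dotDr, dotNl, dotNr) yy (dotC x) yx; lra.
Qed.

Lemma dot_orthonormal n k (F : 'M[R]_(k, n)) i j : F *m F^T = 1%:M ->
  dot (row i F) (row j F) = (i == j)%:R.
Proof. by move=> FF; rewrite dot_row -row_mul FF !mxE. Qed.

(** In the eigenbasis the left side is a weighted sum of eigenvalues. The weight [w j] is the
    squared projection of the j-th eigenvector onto the span of the frame: it lies in [0, 1], and
    the weights add up to k. Such a sum is largest when the weight 1 goes to the k largest
    eigenvalues. *)
Lemma Pplus_ge_frame n k (X : 'M[R]_n) (F : 'M[R]_(k, n)) : X^T = X ->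
  (0 < k <= n)%N -> F *m F^T = 1%:M ->
  \sum_i dot (row i F *m X) (row i F) <= Pplus k X.
Proof.
move=> sX /andP[k0 kn] FF; have [P [PP se ss XE]] := eigenvaluesP sX.
rewrite PplusE//; move: se ss XE; set s := eigenvalues X => se ss XE.
have PtP : P^T *m P = 1%:M by apply: mulmx1C.
pose w (j : 'I_n) := \sum_i dot (row j P) (row i F) ^+ 2.
have w1 j : w j <= 1.
  by apply: le_trans (bessel _ FF) _; rewrite dot_orthonormal// eqxx.
have w0 j : 0 <= w j by apply: sumr_ge0 => i _; rewrite sqr_ge0.
have parseval x : \sum_j dot (row j P) x ^+ 2 = dot x x.
  transitivity (dot (x *m P^T) (x *m P^T)).
    rewrite [RHS]dotE; apply: eq_bigr => j _.
    by rewrite dotC dot_row.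
  by rewrite /dot trmx_mul trmxK mulmxA -(mulmxA x) PtP mulmx1.
have wk : \sum_j w j = k%:R.
  rewrite exchange_big/=; under eq_bigr do rewrite parseval dot_orthonormal// eqxx.
  by rewrite sumr_const card_ord.
have quadE x : dot (x *m X) x = \sum_(j < n) s`_j * dot (row j P) x ^+ 2.
  pose y := x *m P^T.
  have -> : dot (x *m X) x = dot (y *m diag_mx (\row_j s`_j)) y.
    by rewrite /dot /y trmx_mul trmxK XE !mulmxA.
  rewrite dotE; apply: eq_bigr => j _.
  by rewrite mul_mx_diag !mxE (dotC (row j P)) dot_row /y mulrAC -expr2 mulrC mxE.
have -> : \sum_i dot (row i F *m X) (row i F) = \sum_(j < n) s`_j * w j.
  under [RHS]eq_bigr do rewrite mulr_sumr.
  by rewrite exchange_big/=; apply: eq_bigr => i _; exact: quadE.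
set t := s`_(n - k).
have smono i j : (i <= j < n)%N -> s`_i <= s`_j.
  move=> /andP[ij jn]; apply: (sorted_leq_nth le_trans lexx) => //; rewrite inE ss//.
  exact: leq_ltn_trans jn.
have topE (f : nat -> R) : \sum_(n - k <= j < n) f j =
    \sum_(j < n) f j * (n - k <= j)%N%:R.
  rewrite -(big_mkord xpredT (fun j => f j * (n - k <= j)%N%:R)).
  rewrite [RHS](@big_cat_nat _ _ _ (n - k)%N) ?leq_subr//= [X in _ = X + _]big1_seq ?add0r.
    rewrite !big_nat; apply: eq_bigr => j /andP[-> _]; by rewrite mulr1.
  by move=> j; rewrite mem_index_iota /= => jk; rewrite leqNgt jk mulr0.
(* Both factors change sign at the threshold index n - k. The constant [t] cancels afterwards
   because both families of weights have total k. *)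
have : 0 <= \sum_(j < n) (s`_j - t) * ((n - k <= j)%N%:R - w j).
  apply: sumr_ge0 => j _; case: (leqP (n - k) j) => jk.
    by rewrite mulr_ge0// subr_ge0// smono// jk ltn_ord.
  by rewrite mulr_le0// ?subr_le0 ?sub0r ?oppr_le0// smono// (ltnW jk)/=; lia.
have -> : \sum_(j < n) (s`_j - t) * ((n - k <= j)%N%:R - w j) =
   (\sum_(j < n) s`_j * (n - k <= j)%N%:R - \sum_(j < n) t * (n - k <= j)%N%:R)
   - (\sum_(j < n) s`_j * w j - \sum_(j < n) t * w j).
  rewrite -!sumrB; apply: eq_bigr => j _; ring.
rewrite -(topE (fun j => s`_j)) -(topE (fun=> t)) -mulr_sumr wk.
by rewrite sumr_const_nat subKn// -mulr_natr; lra.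
Qed.

(** The extremal frame consists of the last k rows of the eigenbasis, since the eigenvalues
    increase. *)
Lemma Pplus_attained n k (X : 'M[R]_n) : X^T = X -> (k <= n)%N ->
  exists2 F : 'M[R]_(k, n), F *m F^T = 1%:M &
  Pplus k X = \sum_i dot (row i F *m X) (row i F).
Proof.
move=> sX kn; have [P [PP _ _ XE]] := eigenvaluesP sX.
have gP (i : 'I_k) : (n - k + i < n)%N by have := ltn_ord i; lia.
pose g i := Ordinal (gP i).
have g_inj : injective g.
  by move=> i j /(congr1 val)/= /addnI ij; apply: val_inj.
exists (rowsub g P).
  apply/matrixP => i j; have /matrixP/(_ (g i) (g j)) := PP.
  rewrite !mxE (inj_eq g_inj) => <-.
  by apply: eq_bigr => l _; rewrite !mxE.
rewrite PplusE// -[X in \sum_(X <= _ < _) _]add0n big_addn subKn// big_mkord; apply: eq_bigr => i _.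
have rP : row i (rowsub g P) = row (g i) P by apply/rowP => j; rewrite !mxE.
have PXP : P *m X *m P^T = diag_mx (\row_j (eigenvalues X)`_j).
  by rewrite {1}XE !mulmxA PP mul1mx -mulmxA PP mulmx1.
rewrite rP dot_row -!row_mul PXP.
by rewrite !mxE eqxx mulr1n addnC.
Qed.

(** Bessel's inequality is an equality for a frame that starts with x / |x|, or with any unit vector
    when x = 0; the first k rows of a reflection provide it. *)
Lemma frame_through n k (x : 'rV[R]_n) : (0 < k <= n)%N ->
  exists2 F : 'M[R]_(k, n), F *m F^T = 1%:M & \sum_i dot x (row i F) ^+ 2 = dot x x.
Proof.
case: n x => [|n] x; first by lia.
case: k => [//|k] /= kn.
pose e := if x == 0 then delta_mx 0 0 else (Num.sqrt (dot x x))^-1 *: x.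
have xe : x = Num.sqrt (dot x x) *: e.
  rewrite /e; have [->|x0] := eqVneq; first by rewrite dot0l sqrtr0 scale0r.
  rewrite scalerA divff ?scale1r// gt_eqF// sqrtr_gt0 lt_def dot_ge0 andbT.
  by apply: contra_neq x0; exact: dot_eq0.
have e1 : dot e e = 1.
  rewrite /e; have [_|x0] := eqVneq; first by rewrite dot_delta mxE !eqxx.
  rewrite dotZl dotZr mulrA -expr2 exprVn sqr_sqrtr ?dot_ge0// mulVf//.
  by apply: contra_neq x0; exact: dot_eq0.
have [Q QQ Q0] := reflection_to e1.
pose F := rowsub (widen_ord kn) Q.
have FF : F *m F^T = 1%:M.
  apply/matrixP => i j; have /matrixP/(_ (widen_ord kn i) (widen_ord kn j)) := QQ.
  rewrite !mxE => h; rewrite -[RHS]h.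
  by apply: eq_bigr => l _; rewrite !mxE.
exists F => //.
have F0 : row 0 F = e by rewrite -Q0; apply/rowP => j; rewrite !mxE; congr (Q _ _); apply: val_inj.
have dx i : dot x (row i F) = Num.sqrt (dot x x) * (i == 0)%:R.
  by rewrite {1}xe dotZl -F0 dot_orthonormal// eq_sym.
rewrite big_ord_recl big1 => [|i _]; rewrite dx ?mulr0 ?expr0n//.
by rewrite mulr1 addr0 sqr_sqrtr// dot_ge0.
Qed.

(** The frame through x recovers the whole of c |x|^2, for either sign of c. *)
Lemma Pplus_ge n k (X : 'M[R]_n) (x : 'rV[R]_n) (a c : R) : X^T = X ->
  (0 < k <= n)%N ->
  (forall e, dot e e = 1 -> a + c * dot x e ^+ 2 <= dot (e *m X) e) ->
  k%:R * a + c * dot x x <= Pplus k X.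
Proof.
move=> sX kn Xge; have [F FF Fx] := frame_through x kn.
apply: le_trans (Pplus_ge_frame sX kn FF).
rewrite -Fx mulr_sumr mulr_natl -[X in _ *+ X]card_ord -sumr_const -big_split/=.
by apply: ler_sum => i _; apply: Xge; rewrite dot_orthonormal// eqxx.
Qed.

(** The extremal frame need not contain the direction of x, so the radial term is bounded by
    Bessel's inequality, which asks for [0 <= c]. *)
Lemma Pplus_le n k (X : 'M[R]_n) (x : 'rV[R]_n) (a c : R) : X^T = X ->
  (k <= n)%N -> 0 <= c ->
  (forall e, dot e e = 1 -> dot (e *m X) e <= a + c * dot x e ^+ 2) ->
  Pplus k X <= k%:R * a + c * dot x x.
Proof.
move=> sX kn c0 Xle; have [F FF ->] := Pplus_attained sX kn.
apply: le_trans (_ : k%:R * a + c * \sum_i dot x (row i F) ^+ 2 <= _); last first.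
  by rewrite lerD2l ler_wpM2l// bessel.
rewrite mulr_sumr mulr_natl -[X in _ *+ X]card_ord -sumr_const -big_split/=.
by apply: ler_sum => i _; apply: Xle; rewrite dot_orthonormal// eqxx.
Qed.

End KyFan.

(** * Second-order conditions *)

Section Calculus1.
Variable R : realType.

Lemma near_normP (V : normedModType R) (x : V) (P : V -> Prop) :
  (\forall y \near x, P y) <->
  exists2 d : R, 0 < d & forall y, `|y - x| < d -> P y.
Proof.
split=> [/nbhs_normP[d /= d0 dP]|[d d0 dP]].
  by exists d => // y yx; apply: dP; rewrite /ball_/= distrC.
by apply/nbhs_normP; exists d => //= y; rewrite /ball_/= distrC; exact: dP.
Qed.

(** Multiplying out the difference quotient removes the punctured neighbourhood: at h = 0 both sides
    vanish. *)
Lemma is_derive_cvgP (V : normedModType R) (f : V -> R) (x v : V) (l : R) :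
  is_derive x v f l <->
  forall e, 0 < e -> exists2 d : R, 0 < d & forall h, `|h| < d ->
    `|f (h *: v + x) - f x - l * h| <= e * `|h|.
Proof.
have hE h : h != 0 -> forall y : R, `|l - h^-1 * y| = `|y - l * h| / `|h|.
  move=> h0 y; rewrite -normfV -normrM distrC; congr (`|_|).
  by rewrite mulrBl mulfK// mulrC.
split=> [fl e e0|fl].
  have : h^-1 *: (f (h *: v + x) - f x) @[h --> 0^'] --> l.
    have df : derivable f x v by exact: ex_derive.
    by rewrite -(@derive_val _ _ _ _ _ _ _ fl); exact: df.
  move=> /cvgrPdist_le/(_ e e0)/nbhs_normP[d /= d0 dP].
  exists d => // h hd; have [->|h0] := eqVneq h 0.
    by rewrite scale0r add0r subrr mulr0 subr0 normr0 mulr0.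
  have := dP h; rewrite /ball_/= sub0r normrN => /(_ hd h0).
  by rewrite [_ *: _]/(_ * _) hE// ler_pdivrMr ?normr_gt0.
have cv : h^-1 *: (f (h *: v + x) - f x) @[h --> 0^'] --> l.
  apply/cvgrPdist_le => e e0; have [d d0 dP] := fl e e0.
  apply/nbhs_normP; exists d => //= h; rewrite /ball_/= sub0r normrN => hd h0.
  by rewrite [_ *: _]/(_ * _) hE// ler_pdivrMr ?normr_gt0// dP.
apply: DeriveDef; first by apply/cvg_ex; exists l.
exact: (cvg_lim _ cv).
Qed.

Lemma is_derive_ball (f : R -> R) (a l : R) : is_derive a 1 f l -> forall e, 0 < e ->
  exists2 d, 0 < d & forall t, `|t - a| < d -> `|f t - f a - l * (t - a)| <= e * `|t - a|.
Proof.
move=> /is_derive_cvgP fl e /fl[d d0 dP]; exists d => // t /dP.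
by rewrite [_ *: _]mulr1 subrK.
Qed.

Lemma MVT_oo (f f1 : R -> R) (a b : R) : a < b ->
  (forall t : R, a <= t <= b -> is_derive t 1 f (f1 t)) ->
  exists2 c, a < c < b & f b - f a = f1 c * (b - a).
Proof.
move=> ab fd; have [|||c] := @MVT R f f1 a b.
- by [].
- by move=> t; rewrite in_itv/= => /andP[/ltW at_ /ltW tb]; apply: fd; rewrite at_.
- apply: derivable_within_continuous => t; rewrite in_itv/= => /fd ft.
  exact: ex_derive.
by rewrite in_itv/= => abc; exists c.
Qed.

Lemma MVT_abs (f f1 : R -> R) (s : R) :
  (forall t : R, `|t| <= `|s| -> is_derive t 1 f (f1 t)) ->
  exists2 c, `|c| <= `|s| & f s - f 0 = f1 c * s.
Proof.
move=> fd; have [s0|s0|->] := ltgtP s 0; last first.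
- by exists 0; rewrite // !(subrr, mulr0).
- have [|c /andP[c0 cs] e] := @MVT_oo f f1 0 s s0.
    by move=> t /andP[t0 ts]; apply: fd; rewrite !ger0_norm// ltW.
  by exists c; [rewrite !gtr0_norm// ltW|rewrite e subr0].
- have [|c /andP[c0 cs] e] := @MVT_oo f f1 s 0 s0.
    by move=> t /andP[t0 ts]; apply: fd; rewrite !ler0_norm ?lerN2// ltW.
  exists c; first by rewrite !ltr0_norm// lerN2 ltW.
  by rewrite -[LHS]opprB e sub0r mulrN opprK.
Qed.

(** Near a the derivative [g1] has the sign of t - a, and the mean value theorem concludes. The
    second derivative is used at the point a only. *)
Lemma strict_min_second_order (g g1 : R -> R) (a c : R) :
  (\forall t \near a, is_derive (t : R) 1 g (g1 t)) -> g1 a = 0 -> is_derive a 1 g1 c -> 0 < c ->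
  \forall t \near a, t != a -> g a < g t.
Proof.
move=> /near_normP[d d0 gd] g1a g1d c0.
(* An error of at most (c / 2) |t - a| leaves the sign of c (t - a) intact. *)
have c20 : 0 < c / 2 by lra.
have [e e0 ge] := is_derive_ball g1d c20.
apply/near_normP; exists (Num.min d e); first by rewrite lt_min d0.
move=> t; rewrite lt_min => /andP[td te].
rewrite neq_lt => /orP[ta|ta].
  have [|s /andP[ts sa] E] := @MVT_oo g g1 _ _ ta.
    by move=> s /andP[ts sa]; apply: gd; move: td; rewrite !ler0_norm; lra.
  rewrite -subr_lt0 E.
  have := ge s; rewrite g1a (ltr0_norm (_ : s - a < 0)); last by lra.
  rewrite (ltr0_norm (_ : t - a < 0)) in te; last by lra.
  have se : - (s - a) < e by lra.
  move=> /(_ se); rewrite ler_norml subr0 => /andP[_ h].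
  by rewrite pmulr_llt0; nra.
have [|s /andP[ts sa] E] := @MVT_oo g g1 _ _ ta.
  by move=> s /andP[ts sa]; apply: gd; move: td; rewrite !ger0_norm; lra.
rewrite -subr_gt0 E.
have := ge s; rewrite g1a (gtr0_norm (_ : 0 < s - a)); last by lra.
rewrite (gtr0_norm (_ : 0 < t - a)) in te; last by lra.
have se : s - a < e by lra.
move=> /(_ se); rewrite ler_norml subr0 => /andP[h _].
by rewrite pmulr_lgt0; nra.
Qed.

(** If c were positive, a would also be a strict local minimum. *)
Lemma local_max_second_order (g g1 : R -> R) (a c : R) :
  (\forall t \near a, is_derive (t : R) 1 g (g1 t)) -> is_derive a 1 g1 c ->
  (\forall t \near a, g t <= g a) -> c <= 0.
Proof.
move=> gd g1d gmax.
have g1a : g1 a = 0.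
  have /near_normP[d d0 dP] : \forall t \near a, is_derive (t : R) 1 g (g1 t) /\ g t <= g a.
    by apply: filterS2 gd gmax.
  have dI (t : R) : t \in `]a - d, a + d[%R -> `|t - a| < d.
    by rewrite in_itv/= ltr_norml => ?; lra.
  have : is_derive a 1 g 0.
    apply: (@derive1_at_max _ g (a - d) (a + d)) => [|t /dI/dP[gt _]||t /dI/dP[]//].
    - lra.
    - exact: ex_derive.
    - rewrite in_itv/=; lra.
  move=> g0; have [|g0' _] := dP a; first by rewrite subrr normr0.
  by rewrite -(@derive_val _ _ _ _ _ _ _ g0') (@derive_val _ _ _ _ _ _ _ g0).
rewrite leNgt; apply/negP => c0.
have gmin := strict_min_second_order gd g1a g1d c0.
have /near_normP[d d0 dP] : \forall t \near a, (t != a -> g a < g t) /\ g t <= g a.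
  exact: filterS2 gmin gmax.
have [|h1 h2] := dP (a + d / 2); first by rewrite addrAC subrr add0r gtr0_norm; lra.
have da : a + d / 2 != a by rewrite gt_eqF// ltrDl divr_gt0.
by have := h1 da; rewrite ltNge h2.
Qed.

End Calculus1.

(** * Directional derivatives and second-order comparison in several variables *)

Section CalculusN.
Variable R : realType.

Lemma is_derive_line (V : normedModType R) (f : V -> R) (x v : V) (t l : R) :
  is_derive (x + t *: v) v f l <-> is_derive t 1 (fun s : R => f (x + s *: v)) l.
Proof.
rewrite !is_derive_cvgP.
have E (h : R) : x + (h *: 1 + t) *: v = h *: v + (x + t *: v).
  by rewrite [_ *: 1]mulr1 scalerDl addrCA.
by split=> fl e /fl[d d0 dP]; exists d => // h /dP; rewrite /= E.
Qed.

Section DeriveRules.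
Variables (V : normedModType R) (x v : V).
Implicit Types f g : V -> R.

Lemma der_eq f a b : is_derive x v f a -> a = b -> is_derive x v f b.
Proof. by move=> fa <-. Qed.

Lemma der_add f g a b : is_derive x v f a -> is_derive x v g b ->
  is_derive x v (fun y => f y + g y) (a + b).
Proof. exact: is_deriveD. Qed.

Lemma der_opp f a : is_derive x v f a -> is_derive x v (fun y => - f y) (- a).
Proof. exact: is_deriveN. Qed.

Lemma der_mul f g a b : is_derive x v f a -> is_derive x v g b ->
  is_derive x v (fun y => f y * g y) (f x * b + g x * a).
Proof. exact: is_deriveM. Qed.

Lemma der_cst (c : R) : is_derive x v (fun _ => c) 0.
Proof. exact: is_derive_cst. Qed.

End DeriveRules.

Lemma der_pow (x : R) n : is_derive x 1 (fun y : R => y ^+ n) (n%:R * x ^+ n.-1).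
Proof.
apply: DeriveDef; first exact: exprn_derivable.
by rewrite exp_derive [LHS]mulr1.
Qed.

Lemma MVT_line (V : normedModType R) (f p : V -> R) (x v : V) (s : R) :
  (forall t : R, `|t| <= `|s| -> is_derive (x + t *: v) v f (p (x + t *: v))) ->
  exists2 c : R, `|c| <= `|s| & f (x + s *: v) - f x = p (x + c *: v) * s.
Proof.
move=> fd; have [|c cs E] := @MVT_abs R (fun t => f (x + t *: v)) (fun t => p (x + t *: v)) s.
  by move=> t /fd /is_derive_line.
by exists c => //; rewrite -E scale0r addr0.
Qed.

(** The increment along h (a + c b) is split into a step h a and a step h c b; the second is a mean
    value of [p], which is continuous at x. Iterated over the basis, this turns the continuous
    partial derivatives of [C2_on] into derivatives in all directions. *)
Lemma is_derive_addv (V : normedModType R) (f p : V -> R) (x a b : V) (c l : R) :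
  is_derive x a f l -> (\forall y \near x, is_derive y b f (p y)) ->
  {for x, continuous p} -> is_derive x (a + c *: b) f (l + c * p x).
Proof.
move=> fa /near_normP[d1 d10 fb] pc; apply/is_derive_cvgP => e e0.
pose e2 := e / 2 / (`|c| + 1).
have he : 0 < e / 2 by rewrite divr_gt0.
have c1 : 0 < `|c| + 1 by rewrite ltr_wpDl.
have e20 : 0 < e2 by rewrite /e2 !divr_gt0.
have [d2 d20 d2P] := (is_derive_cvgP _ _ _ _).1 fa _ he.
have /near_normP[d3 d30 d3P] : \forall y \near x, `|p x - p y| <= e2.
  by move/cvgrPdist_le : pc => /(_ e2 e20).
(* |h| M bounds the distance from x of every point on the second step. *)
pose M := `|a| + `|c| * `|b| + 1.
have M0 : 0 < M by rewrite /M ltr_wpDl// addr_ge0// mulr_ge0.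
exists (Num.min d2 (Num.min d1 d3 / M)); first by rewrite lt_min d20 divr_gt0// lt_min d10.
move=> h; rewrite lt_min ltr_pdivlMr// lt_min => /and3P[hd2 hd1 hd3].
have close t : `|t| <= `|h * c| -> `|(x + h *: a + t *: b) - x| <= `|h| * M.
  move=> tc; rewrite -(addrA x) [x + _]addrC addrK.
  apply: le_trans (ler_normD _ _) _; rewrite !normrZ.
  rewrite /M !mulrDr mulr1 -addrA lerD2l ler_wpDr// mulrA -normrM.
  by rewrite ler_wpM2r.
have [|t tc E] := @MVT_line V f p (x + h *: a) b (h * c).
  by move=> t /close tc; apply: fb; apply: le_lt_trans hd1.
have := d2P h hd2; have := d3P _ (le_lt_trans (close t tc) hd3).
have -> : h *: (a + c *: b) + x = x + h *: a + (h * c) *: b.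
  by rewrite scalerDr scalerA addrC addrA.
rewrite (addrC (h *: a)) => H1 H2.
have -> : f (x + h *: a + (h * c) *: b) - f x - (l + c * p x) * h =
  (f (x + h *: a) - f x - l * h) + h * c * (p (x + h *: a + t *: b) - p x).
  by rewrite -[f (x + h *: a + _)](subrK (f (x + h *: a))) E; ring.
apply: le_trans (ler_normD _ _) _; rewrite !normrM (distrC (p _)).
have -> : e * `|h| = e / 2 * `|h| + `|h| * (e / 2) by field.
apply: lerD => //; rewrite -mulrA ler_wpM2l//.
apply: le_trans (_ : (`|c| + 1) * e2 <= _); last by rewrite /e2 mulrC divfK// gt_eqF.
by apply: ler_pM => //; rewrite lerDl.
Qed.

Lemma is_derive_dir n (f : 'rV[R]_n -> R) (p : 'I_n -> 'rV[R]_n -> R) x e :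
  (forall i, \forall y \near x, is_derive y (delta_mx 0 i : 'rV[R]_n) f (p i y)) ->
  (forall i, {for x, continuous (p i)}) ->
  is_derive x e f (\sum_i e 0 i * p i x).
Proof.
move=> fp pc; rewrite [e in is_derive _ e]row_sum_delta.
elim: (index_enum _) => [|i r IH]; first by rewrite !big_nil; exact: is_derive0.
rewrite !big_cons addrC (addrC (e 0 i * _)).
exact: is_derive_addv.
Qed.

Section Twice.
Variables (n : nat) (Omega : set 'rV[R]_n) (f : 'rV[R]_n -> R).
Hypotheses (oO : open Omega) (fC2 : C2_on Omega f).

Lemma C2_on_partial x i : Omega x -> is_derive x (delta_mx 0 i : 'rV[R]_n) f (partial i f x).
Proof. by move=> /fC2[_ /(_ i)[df _ _]]; exact: derivableP. Qed.

Lemma C2_on_partial2 x i j : Omega x ->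
  is_derive x (delta_mx 0 j : 'rV[R]_n) (partial i f) (partial j (partial i f) x).
Proof. by move=> /fC2[_ /(_ i)[_ _ /(_ j)[df _]]]; exact: derivableP. Qed.

Lemma near_open x : Omega x -> \forall y \near x, Omega y.
Proof. by move=> Ox; apply: open_nbhs_nbhs; split. Qed.

Lemma C2_on_is_derive x e : Omega x ->
  is_derive x e f (\sum_i e 0 i * partial i f x).
Proof.
move=> Ox; apply: (@is_derive_dir n f (fun i => partial i f)) => i; last first.
  by have [_ /(_ i)[]] := fC2 Ox.
by apply: filterS (near_open Ox) => y; exact: C2_on_partial.
Qed.

Lemma C2_on_is_derive2 x e : Omega x ->
  is_derive x e (fun y => \sum_i e 0 i * partial i f y) (dot (e *m hessian f x) e).
Proof.
move=> Ox.
have d2 i : is_derive x e (partial i f) (\sum_j e 0 j * partial j (partial i f) x).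
  apply: (@is_derive_dir n (partial i f) (fun j => partial j (partial i f)))
    => j; last by have [_ /(_ i)[_ _ /(_ j)[]]] := fC2 Ox.
  by apply: filterS (near_open Ox) => y; exact: C2_on_partial2.
rewrite (_ : (fun y => _) = \sum_(i < n) (fun y => e 0 i * partial i f y)); last first.
  by apply/funext => y; rewrite fct_sumE.
have -> : dot (e *m hessian f x) e =
   \sum_i e 0 i *: (\sum_j e 0 j * partial j (partial i f) x).
  rewrite dotE; under eq_bigr do rewrite mxE mulr_suml.
  rewrite exchange_big/=; apply: eq_bigr => i _; rewrite [RHS]mulr_sumr.
  by apply: eq_bigr => j _; rewrite mxE; ring.
exact: is_derive_sum.
Qed.

Lemma line_near x e : Omega x -> \forall t \near (0 : R), Omega (x + t *: e).
Proof.
move=> /near_open/near_normP[d d0 dP]; apply/near_normP.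
have e1 : 0 < `|e| + 1 by rewrite ltr_wpDl.
exists (d / (`|e| + 1)); first by rewrite divr_gt0.
move=> t; rewrite subr0 ltr_pdivlMr// => td; apply: dP.
rewrite [x + _]addrC addrK normrZ; apply: le_lt_trans td.
by rewrite ler_wpM2l// lerDl.
Qed.

(** The mean value theorem in the direction a, applied to t -> f(x + t a + h b) - f(x + t a), and
    then in the direction b gives h^2 [r] at a point close to x. *)
Lemma second_difference x (a b : 'rV[R]_n) (p r : 'rV[R]_n -> R) :
  (\forall y \near x, is_derive y a f (p y)) ->
  (\forall y \near x, is_derive y b p (r y)) ->
  {for x, continuous r} -> forall e, 0 < e -> exists2 d, 0 < d & forall h : R, 0 < h < d ->
  `|f (x + h *: a + h *: b) - f (x + h *: a) - f (x + h *: b) + f x - h ^+ 2 * r x| <= e * h ^+ 2.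
Proof.
move=> fa pb rc e e0.
have /near_normP[d d0 dP] : \forall y \near x,
    [/\ is_derive y a f (p y), is_derive y b p (r y) & `|r x - r y| <= e].
  by apply: filterS3 fa pb ((cvgrPdist_le _ _).1 rc e e0).
pose M := `|a| + `|b| + 1.
have M0 : 0 < M by rewrite /M ltr_wpDl// addr_ge0.
exists (d / M); first by rewrite divr_gt0.
move=> h /andP[h0]; rewrite ltr_pdivlMr// => hd.
have close s t : `|s| <= `|h| -> `|t| <= `|h| -> `|(x + s *: a + t *: b) - x| < d.
  move=> sh th; apply: le_lt_trans hd.
  rewrite -(addrA x) [x + _]addrC addrK.
  apply: le_trans (ler_normD _ _) _; rewrite !normrZ -(gtr0_norm h0).
  rewrite /M !mulrDr mulr1 -addrA; apply: lerD; first by rewrite ler_wpM2r.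
  by rewrite ler_wpDr// ler_wpM2r.
pose A t := f (x + t *: a + h *: b) - f (x + t *: a).
have [|s sh AE] := @MVT_abs R A (fun t => p (x + t *: a + h *: b) - p (x + t *: a)) h.
  move=> t th; rewrite /A; apply: is_deriveB.
    have [|fx _ _] := dP (x + t *: a + h *: b); first exact: close.
    rewrite (_ : (fun t => _) = fun t => f (x + h *: b + t *: a)); last first.
      by apply/funext => u; rewrite addrAC.
    apply/(is_derive_line f (x + h *: b)).
    rewrite (_ : x + h *: b + t *: a = x + t *: a + h *: b)//; exact: addrAC.
  have [|fx _ _] := dP (x + t *: a).
    by have := close t 0; rewrite scale0r addr0 normr0; apply.
  by apply/(is_derive_line f x).
have [|t th E] := @MVT_line _ p r (x + s *: a) b h.
  by move=> t th; have [] := dP (x + s *: a + t *: b) (close _ _ sh th).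
have [_ _ re] := dP _ (close _ _ sh th).
rewrite (_ : f _ - _ - _ + _ = A h - A 0); last first.
  by rewrite /A scale0r addr0; ring.
rewrite AE E -mulrA -expr2 mulrC -mulrBr normrM distrC mulrC.
by rewrite ger0_norm ?sqr_ge0// ler_wpM2r ?sqr_ge0.
Qed.

Let close2 (S S1 S2 F r1 r2 E : R) : `|S - S1 - S2 + F - r1| <= E ->
  `|S - S2 - S1 + F - r2| <= E -> `|r1 - r2| <= E + E.
Proof.
by rewrite !ler_norml => /andP[? ?] /andP[? ?]; apply/andP; split; lra.
Qed.

(** The second difference is symmetric in the two directions, so both mixed derivatives are limits
    of the same quotient. The bounds on [Pplus] are available only for symmetric matrices. *)
Lemma hessian_sym x : Omega x -> (hessian f x)^T = hessian f x.
Proof.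
move=> Ox; apply/matrixP => i j; rewrite !mxE.
have key k l e : 0 < e -> exists2 d, 0 < d & forall h : R, 0 < h < d ->
  `|f (x + h *: delta_mx 0 k + h *: delta_mx 0 l) - f (x + h *: delta_mx 0 k)
   - f (x + h *: delta_mx 0 l) + f x - h ^+ 2 * partial l (partial k f) x| <= e * h ^+ 2.
  apply: second_difference.
  - by apply: filterS (near_open Ox) => y; exact: C2_on_partial.
  - by apply: filterS (near_open Ox) => y; exact: C2_on_partial2.
  - by have [_ /(_ k)[_ _ /(_ l)[]]] := fC2 Ox.
move: (key i j) (key j i).
move: (partial j _ x) (partial i _ x) => r1 r2 kij kji {key}.
apply/eqP; rewrite -subr_eq0 -normr_le0 leNgt; apply/negP.
rewrite distrC => D0; set D := r1 - r2 in D0.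
(* The two errors add up to 2/3 of |D| h^2, which is less than |D| h^2. *)
have e0 : 0 < `|D| / 3 by rewrite divr_gt0.
have [d1 d10 h1] := kij _ e0; have [d2 d20 h2] := kji _ e0.
pose h := Num.min d1 d2 / 2.
have m0 : 0 < Num.min d1 d2 by rewrite lt_min d10.
have h0 : 0 < h by rewrite divr_gt0.
have hm : h < Num.min d1 d2 by rewrite /h; lra.
move: (hm); rewrite lt_min => /andP[hd1 hd2].
have := h1 h; rewrite h0 hd1 => /(_ isT).
have := h2 h; rewrite h0 hd2 => /(_ isT).
rewrite (addrAC x (h *: delta_mx 0 j)).
move=> H1 H2; have := close2 H2 H1.
rewrite -mulrBr normrM (gtr0_norm (exprn_gt0 2 h0)).
rewrite -[r1 - r2]/D; have := exprn_gt0 2 h0; nra.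
Qed.

End Twice.
(** On the line through x in the direction e, the difference f - g has a local maximum at parameter
    0. *)
Lemma second_order_comparison n (Omega : set 'rV[R]_n) (f g : 'rV[R]_n -> R) x (e : 'rV[R]_n) :
  open Omega -> C2_on Omega f -> C2_on Omega g -> Omega x ->
  (\forall y \near x, f y - g y <= f x - g x) ->
  dot (e *m hessian f x) e <= dot (e *m hessian g x) e.
Proof.
move=> oO fC2 gC2 Ox fg; rewrite -subr_le0.
apply: (@local_max_second_order R (fun t => f (x + t *: e) - g (x + t *: e))
  (fun t => \sum_i e 0 i * partial i f (x + t *: e) - \sum_i e 0 i * partial i g (x + t *: e))).
- apply: filterS (line_near oO e Ox) => t Ot; apply: der_add.
    by apply/(is_derive_line f x e t); exact: (C2_on_is_derive oO fC2).
  by apply: der_opp; apply/(is_derive_line g x e t); exact: (C2_on_is_derive oO gC2).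
- have x0 : x + 0 *: e = x by rewrite scale0r addr0.
  apply: der_add.
    apply/(is_derive_line (fun y => \sum_i e 0 i * partial i f y) x e 0).
    by rewrite x0; exact: (C2_on_is_derive2 oO fC2).
  apply: der_opp; apply/(is_derive_line (fun y => \sum_i e 0 i * partial i g y) x e 0).
  by rewrite x0; exact: (C2_on_is_derive2 oO gC2).
- have : \forall t \near (0 : R), f (x + t *: e) - g (x + t *: e) <= f x - g x.
    move/near_normP : fg => [d d0 dP]; apply/near_normP.
    have e1 : 0 < `|e| + 1 by rewrite ltr_wpDl.
    exists (d / (`|e| + 1)); first by rewrite divr_gt0.
    move=> t; rewrite subr0 ltr_pdivlMr// => td; apply: dP.
    rewrite [x + _]addrC addrK normrZ; apply: le_lt_trans td.
    by rewrite ler_wpM2l// lerDl.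
  by rewrite scale0r addr0.
Qed.

End CalculusN.

(** * Radial test functions *)

Section RadialQuartic.
Variables (R : realType) (n : nat).
Implicit Types x y : 'rV[R]_n.

Lemma der_coord i x v : is_derive x v (fun y : 'rV[R]_n => y 0 i) (v 0 i).
Proof.
apply/is_derive_cvgP => e e0; exists 1 => // h _.
rewrite !mxE addrK mulrC subrr normr0 mulr_ge0// ltW//.
Qed.

Lemma der_dot x v : is_derive x v (fun y : 'rV[R]_n => dot y y) (2 * dot x v).
Proof.
apply/is_derive_cvgP => e e0; have c1 : 0 < dot v v + 1 by rewrite ltr_wpDl// dot_ge0.
exists (e / (dot v v + 1)); first by rewrite divr_gt0.
move=> h; rewrite ltr_pdivlMr// => he.
have -> : dot (h *: v + x) (h *: v + x) - dot x x - 2 * dot x v * h = h * (h * dot v v).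
  by rewrite !(dotDl, dotDr, dotZl, dotZr) (dotC v x); ring.
rewrite !normrM mulrC ler_wpM2r// (ger0_norm (dot_ge0 v)).
apply: le_trans (ltW he); rewrite ler_wpM2l// lerDl//.
Qed.

Variables (A B C t0 : R).

(** Where |x|^2 = t0 the Hessian is 2B I + 8C x^T x: the second derivative is 2B in tangential
    directions and 2B + 8C t0 in the radial one, so both can be prescribed at a point x other than
    0. *)
Definition radial_quartic (y : 'rV[R]_n) : R :=
  A + B * (dot y y - t0) + C * (dot y y - t0) ^+ 2.

Let q1 i y := (B + 2 * C * (dot y y - t0)) * (2 * y 0 i).
Let q2 i j y := (B + 2 * C * (dot y y - t0)) * (2 * (j == i)%:R) + 8 * C * (y 0 i * y 0 j).

Let der_shift x v : is_derive x v (fun y : 'rV[R]_n => dot y y - t0) (2 * dot x v).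
Proof. exact: der_eq (der_add (der_dot x v) (der_cst x v (- t0))) (addr0 _). Qed.

Let der_q x i : is_derive x (delta_mx 0 i : 'rV[R]_n) radial_quartic (q1 i x).
Proof.
set v := delta_mx 0 i; have s := der_shift x v.
apply: der_eq (der_add (der_add (der_cst x v A) (der_mul (der_cst x v B) s))
  (der_mul (der_cst x v C) (der_mul s s))) _.
by rewrite dot_delta /q1; ring.
Qed.

Let der_q1 x i j : is_derive x (delta_mx 0 j : 'rV[R]_n) (q1 i) (q2 i j x).
Proof.
set v := delta_mx 0 j; have s := der_shift x v.
apply: der_eq (der_mul (der_add (der_cst x v B) (der_mul (der_cst x v (2 * C)) s))
  (der_mul (der_cst x v 2) (der_coord i x v))) _.
by rewrite dot_delta /v mxE eqxx /= eq_sym /q2; ring.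
Qed.

Let partial_q i : partial i radial_quartic = q1 i.
Proof. by apply/funext => x; rewrite /partial; apply: derive_val. Qed.

Let partial_q1 i j : partial j (q1 i) = q2 i j.
Proof. by apply/funext => x; rewrite /partial; apply: derive_val. Qed.

Let cont_dot x : {for x, continuous (fun y : 'rV[R]_n => dot y y - t0)}.
Proof. by apply: cont_add; [exact: dot_self_continuous|exact: cont_cst]. Qed.

Let cont_lin x : {for x, continuous (fun y : 'rV[R]_n => B + 2 * C * (dot y y - t0))}.
Proof.
by apply: cont_add; [exact: cont_cst|apply: cont_mul; [exact: cont_cst|exact: cont_dot]].
Qed.

Lemma radial_quartic_C2 Omega : C2_on Omega radial_quartic.
Proof.
move=> x _; split.
  apply: cont_add; last first.
    by apply: cont_mul; [exact: cont_cst|apply: cont_mul; exact: cont_dot].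
  by apply: cont_add; [exact: cont_cst|apply: cont_mul; [exact: cont_cst|exact: cont_dot]].
move=> i; rewrite partial_q; split; first by case: (der_q x i).
  by apply: cont_mul; [exact: cont_lin|apply: cont_mul; [exact: cont_cst|exact: cont_coord]].
move=> j; rewrite partial_q1; split; first by case: (der_q1 x i j).
apply: cont_add; first by apply: cont_mul; [exact: cont_lin|exact: cont_cst].
by apply: cont_mul; [exact: cont_cst|apply: cont_mul; exact: cont_coord].
Qed.

Lemma radial_quartic_hessian x e : dot x x = t0 -> dot e e = 1 ->
  dot (e *m hessian radial_quartic x) e = 2 * B + 8 * C * dot x e ^+ 2.
Proof.
move=> xt e1; have -> : hessian radial_quartic x = (2 * B)%:M + (8 * C) *: (x^T *m x).
  apply/matrixP => i j; rewrite !mxE partial_q partial_q1 /q2 xt subrr mulr0 addr0.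
  rewrite big_ord1 !mxE -mulr_natr [j == i]eq_sym; ring.
rewrite mulmxDr mul_mx_scalar -scalemxAr mulmxA.
have -> : e *m x^T = (dot e x)%:M by rewrite [LHS]mx11_scalar.
by rewrite mul_scalar_mx dotDl !dotZl e1 (dotC e x); ring.
Qed.

Lemma radial_quartic_at x : dot x x = t0 -> radial_quartic x = A.
Proof. by rewrite /radial_quartic => ->; ring. Qed.

End RadialQuartic.

(** * The Euclidean norm and its balls *)

Section Euclid.
Variables (R : realType) (n : nat).
Implicit Types x y : 'rV[R]_n.

Lemma enormE x : enorm x = Num.sqrt (dot x x).
Proof. by rewrite /enorm dotE; congr Num.sqrt; apply: eq_bigr => i _; rewrite expr2. Qed.

Lemma sqr_enorm x : enorm x ^+ 2 = dot x x.
Proof. by rewrite enormE sqr_sqrtr// dot_ge0. Qed.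

Lemma enorm_ge0 x : 0 <= enorm x.
Proof. by rewrite enormE sqrtr_ge0. Qed.

Lemma enorm_continuous : continuous (@enorm R n).
Proof.
rewrite (_ : @enorm R n = fun x => Num.sqrt (dot x x)); last first.
  by apply/funext => x; rewrite enormE.
move=> x; apply: (@continuous_comp _ _ _ (fun x : 'rV[R]_n => dot x x) Num.sqrt).
  exact: dot_self_continuous.
exact: sqrt_continuous.
Qed.

Lemma enormZ a x : enorm (a *: x) = `|a| * enorm x.
Proof.
by rewrite !enormE dotZl dotZr mulrA -expr2 sqrtrM ?sqr_ge0// sqrtr_sqr.
Qed.

Lemma eball_open rho : open (@eball R n rho).
Proof.
apply: (@open_comp _ _ (@enorm R n) [set r | r < rho]); last exact: open_lt.
by move=> x _; exact: enorm_continuous.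
Qed.

Lemma cball_closed rho : closed [set x : 'rV[R]_n | enorm x <= rho].
Proof.
apply: (@closed_comp _ _ (@enorm R n) [set r | r <= rho]); last exact: closed_le.
by move=> x _; exact: enorm_continuous.
Qed.

Lemma closure_eball_sub rho : closure (@eball R n rho) `<=` [set x | enorm x <= rho].
Proof.
rewrite [X in _ `<=` X](closure_id _).1; last exact: cball_closed.
by apply: closureS => x /ltW.
Qed.

Lemma boundary_eball rho x : boundary (@eball R n rho) x -> enorm x = rho.
Proof.
case=> /closure_eball_sub/= xr nx; apply/eqP; rewrite eq_le xr leNgt /=.
by apply/negP => xl; apply: nx; apply: open_nbhs_nbhs; split => //; exact: eball_open.
Qed.

Lemma cball_compact rho : compact [set x : 'rV[R]_n | enorm x <= rho].
Proof.
apply: bounded_closed_compact; last exact: cball_closed.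
exists rho; split; first exact: num_real.
move=> M M1 x /= x1; apply: le_trans (le_trans x1 (ltW M1)).
rewrite [leLHS]mx_normrE; apply/bigmax_leP; split => //= [|[i j] _ /=]; first exact: enorm_ge0.
rewrite (ord1 i) -(@ler_pXn2r _ 2)// ?nnegrE ?enorm_ge0// real_normK ?num_real//.
rewrite sqr_enorm dotE (bigD1 j)//= -expr2.
by rewrite lerDl; apply: sumr_ge0 => k _; rewrite -expr2 sqr_ge0.
Qed.

End Euclid.

(** * The radial equation *)

Section RadialODE.
Variable R : realType.

(** Convergence to 0 at 0+, with no condition on the value at 0: the derivative of [v] there is
    two-sided and would depend on arbitrary values of [v] at negative arguments. *)
Definition small_at_right0 (f : R -> R) :=
  forall e, 0 < e -> exists2 d : R, 0 < d & forall s, 0 < s < d -> `|f s| <= e.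

(** Stands in for integration from 0, where [H] need not be differentiable or even vanish: the mean
    value theorem is applied on [s, r] with s small. *)
Lemma le0_of_derive_le0 (H H1 : R -> R) (r : R) : 0 < r ->
  (forall s : R, 0 < s <= r -> is_derive s 1 H (H1 s)) ->
  (forall s, 0 < s < r -> H1 s <= 0) -> small_at_right0 H -> H r <= 0.
Proof.
move=> r0 Hd H1le H0; rewrite leNgt; apply/negP => Hr.
have h2 : 0 < H r / 2 by rewrite divr_gt0.
have [d d0 dP] := H0 _ h2.
pose m := Num.min d r; have m0 : 0 < m by rewrite lt_min d0.
pose s := m / 2; have s0 : 0 < s by rewrite divr_gt0.
have sm : s < m by rewrite /s; lra.
move: (sm); rewrite lt_min => /andP[sd sr].
have [|c /andP[sc cr] E] := @MVT_oo R H H1 _ _ sr.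
  by move=> t /andP[st tr]; apply: Hd; rewrite tr (lt_le_trans s0).
have := H1le c; rewrite cr (lt_trans s0)// => /(_ isT) Hc.
have := dP s; rewrite s0 sd => /(_ isT); rewrite ler_norml => /andP[_ Hs].
have : H1 c * (r - s) <= 0 by rewrite pmulr_lle0 ?subr_gt0.
rewrite -E; lra.
Qed.

Lemma small_add f g : small_at_right0 f -> small_at_right0 g ->
  small_at_right0 (fun s => f s + g s).
Proof.
move=> f0 g0 e e0; have e2 : 0 < e / 2 by rewrite divr_gt0.
have [d d0 dP] := f0 _ e2; have [d' d'0 dP'] := g0 _ e2.
exists (Num.min d d'); first by rewrite lt_min d0.
move=> s /andP[s0]; rewrite lt_min => /andP[sd sd'].
apply: le_trans (ler_normD _ _) _; rewrite (splitr e).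
by apply: lerD; [apply: dP|apply: dP']; rewrite s0.
Qed.

Lemma small_scale f c : small_at_right0 f -> small_at_right0 (fun s => c * f s).
Proof.
move=> f0 e e0; have c1 : 0 < `|c| + 1 by rewrite ltr_wpDl.
have e2 : 0 < e / (`|c| + 1) by rewrite divr_gt0.
have [d d0 dP] := f0 _ e2; exists d => // s /dP h.
rewrite normrM; apply: le_trans (_ : (`|c| + 1) * `|f s| <= _).
  by rewrite ler_wpM2r// lerDl.
by rewrite mulrC -ler_pdivlMr.
Qed.

Lemma small_powM f n : small_at_right0 f -> small_at_right0 (fun s => s ^+ n * f s).
Proof.
move=> f0 e e0; have [d d0 dP] := f0 _ e0.
exists (Num.min d 1); first by rewrite lt_min d0/=.
move=> s /andP[s0]; rewrite lt_min => /andP[sd s1].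
rewrite normrM -[leRHS]mul1r ler_pM//.
  by rewrite normrX gtr0_norm// exprn_ile1// ltW.
by apply: dP; rewrite s0.
Qed.

Lemma small_id : small_at_right0 id.
Proof.
by move=> e e0; exists e => // s /andP[s0 se]; rewrite gtr0_norm// ltW.
Qed.

Lemma small_pow n : small_at_right0 (fun s => s ^+ n.+1).
Proof.
move=> e /(small_powM n small_id)[d d0 dP]; exists d => // s /dP.
by rewrite exprSr.
Qed.

(** [K.+1] is the dimension k of the smaller ball; [v1] and [v2] are v' and v''. *)
Variables (K : nat) (rho mu : R) (v v1 v2 : R -> R).
Hypotheses (rho0 : 0 < rho) (v_gt0 : forall r : R, 0 <= r -> r < rho -> 0 < v r).
Hypothesis v_cont : forall r0 e : R, 0 <= r0 <= rho -> 0 < e ->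
  exists2 d : R, 0 < d & forall r : R, 0 <= r <= rho -> `|r - r0| < d -> `|v r - v r0| <= e.
Hypothesis v_rho : v rho = 0.
Hypothesis dv : forall r : R, 0 < r < rho -> is_derive r 1 v (v1 r).
Hypothesis dv1 : forall r : R, 0 < r < rho -> is_derive r 1 v1 (v2 r).
Hypothesis ode : forall r : R, 0 < r < rho -> v2 r + K%:R / r * v1 r + mu * v r = 0.
Hypothesis v1_0 : small_at_right0 v1.

(** The equation in divergence form: (r^K v')' = - mu r^K v. *)
Let dG (r : R) : 0 < r < rho ->
  is_derive r 1 (fun s => s ^+ K * v1 s) (- (r ^+ K * (mu * v r))).
Proof.
move=> rr; apply: der_eq (der_mul (der_pow r K) (dv1 rr)) _.
have r0 : r != 0 by case/andP: rr => r0 _; rewrite gt_eqF.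
have -> : v2 r = - (K%:R / r * v1 r) - mu * v r by have := ode rr; lra.
by case: (K) => [|j] /=; rewrite ?exprS; field.
Qed.

Let dP (c r : R) : is_derive r 1 (fun s : R => c / K.+1%:R * s ^+ K.+1) (r ^+ K * c).
Proof.
apply: der_eq (der_mul (der_cst _ _ (c / K.+1%:R)) (der_pow r K.+1)) _.
by rewrite mulr0 addr0 mulrA divfK//= mulrC.
Qed.

Let GK (c r : R) : 0 < r ->
  r ^+ K * v1 r + c / K.+1%:R * r ^+ K.+1 = r ^+ K * (v1 r + c * r / K.+1%:R).
Proof. by move=> r0; rewrite exprSr; field. Qed.

(** The flux r^K v' is compared with -c r^(K+1) / (K+1), the flux of a constant source c; both
    vanish at 0+. *)
Lemma flux_upper (c r : R) : 0 < r < rho -> (forall s, 0 < s < r -> c <= mu * v s) ->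
  v1 r + c * r / K.+1%:R <= 0.
Proof.
move=> /andP[r0 rr] cv.
have : r ^+ K * v1 r + c / K.+1%:R * r ^+ K.+1 <= 0.
  apply: (@le0_of_derive_le0 (fun s => s ^+ K * v1 s + c / K.+1%:R * s ^+ K.+1)
    (fun s => - (s ^+ K * (mu * v s)) + s ^+ K * c)) => //.
  - move=> s /andP[s0 sr]; apply: der_add; [apply: dG|exact: dP].
    by rewrite s0 (le_lt_trans sr).
  - move=> s /[dup] /andP[s0 sr] /cv cs; rewrite addrC -mulrBr.
    by rewrite mulr_ge0_le0// ?exprn_ge0 ?subr_le0// ltW.
  - by apply: small_add; [exact: small_powM|apply: small_scale; exact: small_pow].
by rewrite GK// pmulr_rle0// exprn_gt0.
Qed.

Lemma flux_lower (c r : R) : 0 < r < rho -> (forall s, 0 < s < r -> mu * v s <= c) ->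
  0 <= v1 r + c * r / K.+1%:R.
Proof.
move=> /andP[r0 rr] cv.
have : - (r ^+ K * v1 r + c / K.+1%:R * r ^+ K.+1) <= 0.
  apply: (@le0_of_derive_le0 (fun s => - (s ^+ K * v1 s + c / K.+1%:R * s ^+ K.+1))
    (fun s => - (- (s ^+ K * (mu * v s)) + s ^+ K * c))) => //.
  - move=> s /andP[s0 sr]; apply: der_opp; apply: der_add; [apply: dG|exact: dP].
    by rewrite s0 (le_lt_trans sr).
  - move=> s /[dup] /andP[s0 sr] /cv cs; rewrite addrC -mulrBr oppr_le0.
    by rewrite mulr_ge0// ?exprn_ge0 ?subr_ge0// ltW.
  - move=> e e0; suff [d d0 h] : exists2 d : R, 0 < d & forall s, 0 < s < d ->
        `|s ^+ K * v1 s + c / K.+1%:R * s ^+ K.+1| <= e.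
      by exists d => // s /h; rewrite normrN.
    by apply: small_add e0; [exact: small_powM|apply: small_scale; exact: small_pow].
by rewrite oppr_le0 GK// pmulr_rge0// exprn_gt0.
Qed.

(** For mu <= 0 the flux would be nonnegative and v nondecreasing, against v(rho / 2) > 0 =
    v(rho). *)
Lemma eigenvalue_gt0 : 0 < mu.
Proof.
rewrite ltNge; apply/negP => mu0.
have v1_ge0 r : 0 < r < rho -> 0 <= v1 r.
  move=> /[dup] rr /andP[r0 rr']; have := @flux_lower 0 r rr.
  rewrite mul0r mul0r addr0; apply => s /andP[s0 sr].
  by rewrite mulr_le0_ge0// ltW// v_gt0 ?ltW// (lt_trans sr).
have h0 : 0 < rho / 2 by rewrite divr_gt0.
have hr : rho / 2 < rho by lra.
have vh : 0 < v (rho / 2) by rewrite v_gt0// ltW.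
have vh2 : 0 < v (rho / 2) / 2 by rewrite divr_gt0.
have [|d d0 dvr] := @v_cont rho _ _ vh2; first by rewrite lexx ltW.
pose m := Num.min d (rho / 2); have m0 : 0 < m by rewrite lt_min d0.
have [md mh] : m <= d /\ m <= rho / 2 by rewrite !ge_min !lexx orbT.
(* So close to [rho] that v(r) <= v(rho / 2) / 2, by continuity at [rho]. *)
pose r := rho - m / 2; have rr : rho / 2 < r by rewrite /r; lra.
have rrho : r < rho by rewrite /r; lra.
have [|c /andP[hc cr] E] := @MVT_oo R v v1 _ _ rr.
  by move=> t /andP[ht tr]; apply: dv; lra.
have : 0 <= v1 c * (r - rho / 2) by rewrite mulr_ge0 ?subr_ge0 ?v1_ge0// ?ltW//; lra.
have := dvr r; rewrite v_rho subr0 ltr0_norm; last by rewrite subr_lt0.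
rewrite ger0_norm; last by rewrite ltW// v_gt0//; lra.
have r1 : 0 <= r <= rho by lra.
have r2 : - (r - rho) < d by rewrite /r; lra.
move=> /(_ r1 r2); rewrite -E; lra.
Qed.

Lemma v1_le0 r : 0 < r < rho -> v1 r <= 0.
Proof.
move=> /[dup] rr /andP[r0 rr']; have := @flux_upper 0 r rr.
rewrite mul0r mul0r addr0; apply => s /andP[s0 sr].
by rewrite mulr_ge0// ltW ?eigenvalue_gt0// v_gt0 ?ltW// (lt_trans sr).
Qed.

Lemma v_nonincr s r : 0 < s < r -> r < rho -> v r <= v s.
Proof.
move=> /andP[s0 sr] rr; have [|c /andP[sc cr] E] := @MVT_oo R v v1 _ _ sr.
  by move=> t /andP[st tr]; apply: dv; lra.
have c1 : v1 c <= 0 by apply: v1_le0; lra.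
have : v1 c * (r - s) <= 0 by rewrite pmulr_lle0 ?subr_gt0.
rewrite -E; lra.
Qed.

(* This makes v'' the largest eigenvalue of the Hessian of v(|x|). *)
Lemma radial_eigenvalue_max r : 0 < r < rho -> v1 r / r <= v2 r.
Proof.
move=> /[dup] rr /andP[r0 rr'].
(* As v is nonincreasing, mu v(r) bounds the source on (0, r) from below. By the equation, v'' -
   v'/r is a negative multiple of the resulting nonpositive quantity. *)
have := @flux_upper (mu * v r) r rr.
have h s : 0 < s < r -> mu * v r <= mu * v s.
  by move=> sr; apply: ler_wpM2l; [exact: ltW eigenvalue_gt0|exact: v_nonincr sr rr'].
move=> /(_ h) {}h.
have -> : v2 r = - (K%:R / r * v1 r) - mu * v r by have := ode rr; lra.
rewrite -subr_ge0; have -> : - (K%:R / r * v1 r) - mu * v r - v1 r / r =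
   (- (K.+1%:R / r)) * (v1 r + mu * v r * r / K.+1%:R).
  by rewrite -[in RHS]natr1; field; rewrite natr1 gt_eqF//= gt_eqF.
by rewrite mulr_le0// oppr_le0 divr_ge0// ltW.
Qed.

Let dsq (c r : R) : is_derive r 1 (fun s : R => c / 2 * s ^+ 2) (c * r).
Proof.
apply: der_eq (der_mul (der_cst _ _ (c / 2)) (der_pow r 2)) _.
by rewrite /=; field.
Qed.

Let v_small : small_at_right0 (fun s => v s - v 0).
Proof.
move=> e e0; have [|d d0 dvr] := @v_cont 0 _ _ e0; first by rewrite lexx ltW.
exists (Num.min d rho); first by rewrite lt_min d0.
move=> s /andP[s0]; rewrite lt_min => /andP[sd sr]; apply: dvr; first by lra.
by rewrite subr0 gtr0_norm.
Qed.

Let mu_v_near0 e : 0 < e -> exists2 d : R, 0 < d <= rho & forall s, 0 < s < d ->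
  mu * v 0 - e <= mu * v s <= mu * v 0 + e.
Proof.
move=> /(small_scale mu v_small)[d d0 h].
exists (Num.min d rho); first by rewrite lt_min d0 rho0 ge_min lexx orbT.
move=> s /andP[s0]; rewrite lt_min => /andP[sd sr].
have := h s; rewrite s0 sd => /(_ isT); rewrite ler_norml mulrBr => /andP[? ?]; lra.
Qed.

(** No second derivative at 0 is available. The flux bound with the constant c = mu v(0) + e, valid
    near 0 by continuity, is integrated once more instead. *)
Lemma v_lower0 e : 0 < e -> exists2 d : R, 0 < d & forall r, 0 < r < d ->
  v 0 - (mu * v 0 + e) / K.+1%:R / 2 * r ^+ 2 <= v r.
Proof.
move=> /mu_v_near0[d /andP[d0 dr] h]; exists d => // r /andP[r0 rd].
set c := (mu * v 0 + e) / K.+1%:R.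
rewrite -subr_le0.
have -> : v 0 - c / 2 * r ^+ 2 - v r = - ((v r - v 0) + c / 2 * r ^+ 2) by ring.
apply: (@le0_of_derive_le0 (fun r => - ((v r - v 0) + c / 2 * r ^+ 2))
  (fun r => - ((v1 r - 0) + c * r))) => //.
- move=> s /andP[s0 sr]; apply: der_opp; apply: der_add; last exact: dsq.
  by apply: der_add; apply: dv; lra.
- move=> s /andP[s0 sr]; rewrite subr0 oppr_le0.
  have -> : c * s = (mu * v 0 + e) * s / K.+1%:R by rewrite /c mulrAC.
  apply: flux_lower; first lra.
  by move=> t /andP[t0 ts]; have := h t; rewrite t0 (_ : t < d); [move=> /(_ isT)/andP[]|lra].
- move=> e1 e10; suff [d1 d10 h1] : exists2 d : R, 0 < d & forall s, 0 < s < d ->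
        `|v s - v 0 + c / 2 * s ^+ 2| <= e1.
      by exists d1 => // s /h1; rewrite normrN.
  by apply: small_add e10; [exact: v_small|apply: small_scale; exact: small_pow].
Qed.

Lemma v_upper0 e : 0 < e -> exists2 d : R, 0 < d & forall r, 0 < r < d ->
  v r <= v 0 - (mu * v 0 - e) / K.+1%:R / 2 * r ^+ 2.
Proof.
move=> /mu_v_near0[d /andP[d0 dr] h]; exists d => // r /andP[r0 rd].
set c := (mu * v 0 - e) / K.+1%:R.
rewrite -subr_le0.
have -> : v r - (v 0 - c / 2 * r ^+ 2) = (v r - v 0) + c / 2 * r ^+ 2 by ring.
apply: (@le0_of_derive_le0 (fun r => (v r - v 0) + c / 2 * r ^+ 2)
  (fun r => (v1 r - 0) + c * r)) => //.
- move=> s /andP[s0 sr]; apply: der_add; last exact: dsq.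
  by apply: der_add; apply: dv; lra.
- move=> s /andP[s0 sr]; rewrite subr0.
  have -> : c * s = (mu * v 0 - e) * s / K.+1%:R by rewrite /c mulrAC.
  apply: flux_upper; first lra.
  by move=> t /andP[t0 ts]; have := h t; rewrite t0 (_ : t < d); [move=> /(_ isT)/andP[]|lra].
- by apply: small_add; [exact: v_small|apply: small_scale; exact: small_pow].
Qed.

Let quartic (A b c t r : R) := A + b * (r ^+ 2 - t) + c * (r ^+ 2 - t) ^+ 2.
Let quartic1 (b c t r : R) := 2 * b * r + 4 * c * r * (r ^+ 2 - t).

Let dshift (t r : R) : is_derive r 1 (fun s : R => s ^+ 2 - t) (2 * r).
Proof. by apply: der_eq (der_add (der_pow r 2) (der_cst _ _ (- t))) _; rewrite addr0. Qed.

Let dquartic (A b c t r : R) : is_derive r 1 (quartic A b c t) (quartic1 b c t r).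
Proof.
have s := dshift t r.
apply: der_eq (der_add (der_add (der_cst _ _ A) (der_mul (der_cst _ _ b) s))
  (der_mul (der_cst _ _ c) (der_mul s s))) _.
by rewrite /quartic1; ring.
Qed.

Let did (r : R) : is_derive r 1 (fun s : R => s) 1.
Proof. exact: is_derive_id. Qed.

Let dquartic1 (b c r : R) : is_derive r 1 (quartic1 b c (r ^+ 2)) (2 * b + 8 * c * r ^+ 2).
Proof.
apply: der_eq (der_add (der_mul (der_cst _ _ (2 * b)) (did r))
  (der_mul (der_mul (der_cst _ _ (4 * c)) (did r)) (dshift (r ^+ 2) r))) _.
by ring.
Qed.

Let near_interior (r : R) : 0 < r < rho -> \forall s \near r, 0 < s < rho.
Proof.
move=> /andP[r0 rr]; apply/near_normP; exists (Num.min r (rho - r)).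
  by rewrite lt_min r0 subr_gt0.
by move=> s; rewrite lt_min !ltr_norml => /andP[/andP[? ?] /andP[? ?]]; lra.
Qed.

(** At r0 > 0 the quartic has the value and slope of v and second derivative v'' - eta, so it lies
    below v nearby. Its coefficients satisfy 2b = v'/r0 and 2b + 8c r0^2 = v'' - eta, and the
    equation turns the trace-like sum into - mu v - eta. *)
Lemma radial_quartic_below r0 eta : 0 <= r0 < rho -> 0 < eta ->
  exists b c, - mu * v r0 - eta <= 2 * b * K.+1%:R + 8 * c * r0 ^+ 2 /\
  exists2 d : R, 0 < d & forall r, 0 <= r -> `|r - r0| < d ->
    v r0 + b * (r ^+ 2 - r0 ^+ 2) + c * (r ^+ 2 - r0 ^+ 2) ^+ 2 <= v r.
Proof.
move=> /andP[]; rewrite le_eqVlt => /predU1P[<- _|r00 rr] eta0.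
  (* At the origin the quadratic bound suffices, with no quartic term. *)
  exists (- ((mu * v 0 + eta) / K.+1%:R / 2)), 0; split.
    by rewrite le_eqVlt; apply/orP; left; apply/eqP; field; rewrite addrC natr1.
  have [d d0 h] := v_lower0 eta0; exists d => // r; rewrite le_eqVlt => /predU1P[<- _|rp].
    by rewrite subrr !mulr0 !addr0 expr0n mulr0 addr0.
  rewrite subr0 gtr0_norm// => rd; have := h r; rewrite rp rd => /(_ isT).
  by rewrite expr0n/= subr0 mul0r addr0 mulNr.
pose b := v1 r0 / (2 * r0); pose c := (v2 r0 - 2 * b - eta) / (8 * r0 ^+ 2).
have r0N : r0 != 0 by rewrite gt_eqF.
have rI : 0 < r0 < rho by rewrite r00.
have cE : 8 * c * r0 ^+ 2 = v2 r0 - 2 * b - eta by rewrite /c; field.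
have bE : 2 * b * r0 = v1 r0 by rewrite /b; field.
exists b, c; split.
  rewrite cE; have := ode rI; rewrite -natr1 -bE.
  have -> : K%:R / r0 * (2 * b * r0) = K%:R * (2 * b) by field.
  lra.
have : \forall s \near r0, s != r0 ->
    v r0 - quartic (v r0) b c (r0 ^+ 2) r0 < v s - quartic (v r0) b c (r0 ^+ 2) s.
  have g0 : v1 r0 - quartic1 b c (r0 ^+ 2) r0 = 0.
    by rewrite /quartic1 subrr mulr0 addr0 bE subrr.
  have gd : \forall s \near r0, is_derive (s : R) 1
      (fun r => v r - quartic (v r0) b c (r0 ^+ 2) r) (v1 s - quartic1 b c (r0 ^+ 2) s).
    apply: filterS (near_interior rI) => s sI.
    exact: (der_add (dv sI) (der_opp (dquartic (v r0) b c (r0 ^+ 2) s))).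
  have gd1 : is_derive r0 1 (fun r => v1 r - quartic1 b c (r0 ^+ 2) r) eta.
    apply: der_eq (der_add (dv1 rI) (der_opp (dquartic1 b c r0))) _.
    by rewrite cE; ring.
  exact: (strict_min_second_order gd g0 gd1 eta0).
move=> /near_normP[d d0 h]; exists d => // r _ rd.
have [->|rr0] := eqVneq r r0; first by rewrite subrr expr0n !mulr0 !addr0.
have := h r rd rr0; rewrite /quartic subrr expr0n !mulr0 !addr0; lra.
Qed.

(** The same fit with v'' + eta. Here 8c r0^2 = v'' - v'/r0 + eta, which is nonnegative by
    [radial_eigenvalue_max]. *)
Lemma radial_quartic_above r0 eta : 0 <= r0 < rho -> 0 < eta ->
  exists b c, [/\ 0 <= c, 2 * b * K.+1%:R + 8 * c * r0 ^+ 2 <= - mu * v r0 + eta &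
  exists2 d : R, 0 < d & forall r, 0 <= r -> `|r - r0| < d ->
    v r <= v r0 + b * (r ^+ 2 - r0 ^+ 2) + c * (r ^+ 2 - r0 ^+ 2) ^+ 2].
Proof.
move=> /andP[]; rewrite le_eqVlt => /predU1P[<- _|r00 rr] eta0.
  exists (- ((mu * v 0 - eta) / K.+1%:R / 2)), 0; split => //.
    by rewrite le_eqVlt; apply/orP; left; apply/eqP; field; rewrite addrC natr1.
  have [d d0 h] := v_upper0 eta0; exists d => // r; rewrite le_eqVlt => /predU1P[<- _|rp].
    by rewrite subrr !mulr0 !addr0 expr0n mulr0 addr0.
  rewrite subr0 gtr0_norm// => rd; have := h r; rewrite rp rd => /(_ isT).
  by rewrite expr0n/= subr0 mul0r addr0 mulNr.
pose b := v1 r0 / (2 * r0); pose c := (v2 r0 - 2 * b + eta) / (8 * r0 ^+ 2).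
have r0N : r0 != 0 by rewrite gt_eqF.
have rI : 0 < r0 < rho by rewrite r00.
have cE : 8 * c * r0 ^+ 2 = v2 r0 - 2 * b + eta by rewrite /c; field.
have bE : 2 * b * r0 = v1 r0 by rewrite /b; field.
have bE' : 2 * b = v1 r0 / r0 by rewrite /b; field.
exists b, c; split.
- rewrite /c divr_ge0//; last by rewrite mulr_ge0// ltW// exprn_gt0.
  by rewrite bE' addr_ge0 ?subr_ge0 ?radial_eigenvalue_max// ltW.
- rewrite cE; have := ode rI; rewrite -natr1 -bE.
  have -> : K%:R / r0 * (2 * b * r0) = K%:R * (2 * b) by field.
  lra.
have : \forall s \near r0, s != r0 ->
    quartic (v r0) b c (r0 ^+ 2) r0 - v r0 < quartic (v r0) b c (r0 ^+ 2) s - v s.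
  have g0 : quartic1 b c (r0 ^+ 2) r0 - v1 r0 = 0.
    by rewrite /quartic1 subrr mulr0 addr0 bE subrr.
  have gd : \forall s \near r0, is_derive (s : R) 1
      (fun r => quartic (v r0) b c (r0 ^+ 2) r - v r) (quartic1 b c (r0 ^+ 2) s - v1 s).
    apply: filterS (near_interior rI) => s sI.
    exact: (der_add (dquartic (v r0) b c (r0 ^+ 2) s) (der_opp (dv sI))).
  have gd1 : is_derive r0 1 (fun r => quartic1 b c (r0 ^+ 2) r - v1 r) eta.
    apply: der_eq (der_add (dquartic1 b c r0) (der_opp (dv1 rI))) _.
    by rewrite cE; ring.
  exact: (strict_min_second_order gd g0 gd1 eta0).
move=> /near_normP[d d0 h]; exists d => // r _ rd.
have [->|rr0] := eqVneq r r0; first by rewrite subrr expr0n !mulr0 !addr0.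
have := h r rd rr0; rewrite /quartic subrr expr0n !mulr0 !addr0; lra.
Qed.

End RadialODE.

(** * Semicontinuity and the radial profile *)

Section Semicontinuity.
Variable R : realType.

Lemma within_lsc_in n (Omega : set 'rV[R]_n) (f : 'rV[R]_n -> R) :
  {within Omega, continuous f} -> lsc_in Omega f.
Proof.
move=> cf x a; rewrite lte_fin => ax.
exists [set y | a < f y]; last by move=> y /=; rewrite lte_fin.
by apply: (cf x [set y | a < y]); exact: lt_nbhsr.
Qed.

Lemma within_usc_in n (Omega : set 'rV[R]_n) (f : 'rV[R]_n -> R) :
  {within Omega, continuous f} -> usc_in Omega f.
Proof.
move=> cf; apply: within_lsc_in => x.
exact: (@cvgN _ _ _ _ _ f (f x) (cf x)).
Qed.

Lemma lsc_in_near n (Omega : set 'rV[R]_n) (f : 'rV[R]_n -> R) x a :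
  open Omega -> lsc_in Omega f -> Omega x -> a < f x -> \forall y \near x, a < f y.
Proof.
move=> oO lf Ox; rewrite -lte_fin => /lf[V + Vf].
rewrite -nbhs_subspace_interior; last by rewrite (interior_id _).1.
by apply: filterS => y /Vf; rewrite lte_fin.
Qed.

(** The sets {g <= g(t)} form a filter base on [K]. A cluster point is a minimiser: by lower
    semicontinuity, a smaller value g(t) would exclude {g <= g(t)} from a neighbourhood of it. *)
Lemma compact_min (T : topologicalType) (K : set T) (g : T -> R) :
  compact K -> K !=set0 ->
  (forall x a, K x -> a < g x -> \forall y \near x, K y -> a < g y) ->
  exists2 c, K c & forall t, K t -> g c <= g t.
Proof.
move=> cK [k0 Kk0] lg.
pose B t := [set y | K y /\ g y <= g t].
have FF : Filter (filter_from K B).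
  apply: filter_from_filter; first by exists k0.
  move=> i j Ki Kj; case: (leP (g i) (g j)) => ij.
    by exists i => // y [Ky yi]; do 2 split => //; exact: le_trans ij.
  by exists j => // y [Ky yi]; do 2 split => //; exact: le_trans (ltW ij).
have PF : ProperFilter (filter_from K B).
  by apply: filter_from_proper => t Kt; exists t.
have [|c [Kc cF]] := cK _ PF; first by exists k0 => // y [].
exists c => // t Kt; rewrite leNgt; apply/negP => tc.
have [|y [[Ky yt] /(_ Ky)]] := cF (B t) _ _ (lg c _ Kc tc).
  by exists t.
by rewrite ltNge yt.
Qed.

Lemma within_continuousP (V : normedModType R) (A : set V) (f : V -> R) :
  {within A, continuous f} <->
  forall x, A x -> forall e, 0 < e ->
    exists2 d : R, 0 < d & forall y, A y -> `|y - x| < d -> `|f y - f x| <= e.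
Proof.
rewrite subspace_continuousP; split=> [cf x Ax e e0|cf x Ax].
  have /cvgrPdist_le/(_ e e0) := cf x Ax.
  move=> /nbhs_normP[d /= d0 dP]; exists d => // y Ay yx; rewrite distrC.
  by apply: dP => //; rewrite /ball_/= distrC.
apply/cvgrPdist_le => e e0; have [d d0 dP] := cf x Ax e e0.
by apply/nbhs_normP; exists d => //= y; rewrite /ball_/= distrC => yx Ay; rewrite distrC dP.
Qed.

End Semicontinuity.

(** * Passage between the profile and radial functions on balls *)

Section RadialProfile.
Variable R : realType.

Lemma closure_eball n (rho : R) (x : 'rV[R]_n) : 0 < rho -> enorm x <= rho ->
  closure (eball rho) x.
Proof.
move=> rho0 xr B /near_normP[d d0 dP].
have x1 : 0 < `|x| + 1 by rewrite ltr_wpDl.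
pose m := Num.min (d / (`|x| + 1)) 1.
have m0 : 0 < m by rewrite lt_min divr_gt0/=.
pose t := m / 2; have tm : t < m by rewrite /t; lra.
have t0 : 0 < t by rewrite divr_gt0.
move: tm; rewrite lt_min ltr_pdivlMr// => /andP[td t1].
exists ((1 - t) *: x); split.
  rewrite /eball/= enormZ gtr0_norm ?subr_gt0//.
  have : 0 <= t * (rho - enorm x) by rewrite mulr_ge0// ?subr_ge0// ltW.
  have : 0 < t * rho by rewrite mulr_gt0.
  move: xr; rewrite !mulrBr !mulrBl !mul1r.
  nra.
apply: dP; rewrite scalerBl scale1r addrAC subrr add0r normrN normrZ gtr0_norm//.
by apply: le_lt_trans td; rewrite ler_wpM2l ?lerDl// ltW.
Qed.

Lemma within_closed_ball n (rho : R) (f : 'rV[R]_n -> R) : 0 < rho ->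
  {within closure (eball rho), continuous f} <->
  {within [set x | enorm x <= rho], continuous f}.
Proof.
move=> rho0; rewrite (_ : closure (eball rho) = [set x | enorm x <= rho])//.
apply/seteqP; split; first exact: closure_eball_sub.
by move=> x; exact: closure_eball.
Qed.

Lemma radial_within n (v : R -> R) (rho : R) :
  (forall r0 e : R, 0 <= r0 <= rho -> 0 < e -> exists2 d : R, 0 < d &
    forall r : R, 0 <= r <= rho -> `|r - r0| < d -> `|v r - v r0| <= e) ->
  {within [set x : 'rV[R]_n | enorm x <= rho], continuous (fun x => v (enorm x))}.
Proof.
move=> vc; apply/within_continuousP => x /= xr e e0.
have [|d d0 dP] := vc (enorm x) e _ e0; first by rewrite enorm_ge0.
have /near_normP[d1 d10 d1P] : \forall y \near x, `|enorm x - enorm y| < d.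
  by have /cvgrPdist_lt/(_ d d0) := @enorm_continuous R n x.
exists d1 => // y /= yr /d1P; rewrite distrC; apply: dP.
by rewrite enorm_ge0.
Qed.

Lemma enorm_axis n (r : R) : enorm (r *: (delta_mx 0 0 : 'rV[R]_n.+1)) = `|r|.
Proof. by rewrite enormZ enormE dot_delta mxE !eqxx sqrtr1 mulr1. Qed.

Variables (K : nat) (rho : R) (v : R -> R).
Let f := fun x : 'rV[R]_K.+1 => v (enorm x).
Let e0 : 'rV[R]_K.+1 := delta_mx 0 0.
Hypothesis rho0 : 0 < rho.

(** On the first coordinate axis the radial function is v(|t|). *)
Lemma profile_continuous : {within closure (eball rho), continuous f} ->
  forall r0 e : R, 0 <= r0 <= rho -> 0 < e -> exists2 d : R, 0 < d &
    forall r : R, 0 <= r <= rho -> `|r - r0| < d -> `|v r - v r0| <= e.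
Proof.
move=> /(within_closed_ball _ rho0)/within_continuousP fc r0 e /andP[r00 r0r] ee.
have := fc (r0 *: e0); rewrite /= enorm_axis ger0_norm// => /(_ r0r e ee)[d d0 dP].
have n1 : 0 < `|e0| + 1 by rewrite ltr_wpDl.
exists (d / (`|e0| + 1)); first by rewrite divr_gt0.
move=> r /andP[rr0 rr]; rewrite ltr_pdivlMr// => rd.
have := dP (r *: e0); rewrite /= /f !enorm_axis (ger0_norm rr0) (ger0_norm r00).
move=> h; apply: h => //.
rewrite -scalerBl normrZ; apply: le_lt_trans rd.
by rewrite ler_wpM2l// lerDl.
Qed.

(** Differentiability at 0 alone does not make v' tend to 0. Along the first axis, however, v' is a
    partial derivative of a C^2 function, hence continuous at the origin, and the right difference
    quotient identifies its value there as 0. *)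
Lemma profile_derivative_small : C2_on (eball rho) f ->
  (forall r : R, 0 < r < rho -> derivable v r 1) ->
  h^-1 * (v h - v 0) @[h --> 0^'+] --> (0 : R) ->
  small_at_right0 v^`()%classic.
Proof.
move=> fC2 dv v0.
have O0 : eball rho (0 : 'rV[R]_K.+1) by rewrite /eball/= enormE dot0l sqrtr0.
have dline t : 0 <= t < rho ->
    is_derive t 1 (fun s : R => v `|s|) (partial 0 f (t *: e0)).
  move=> /andP[t0 tr]; have := @is_derive_line _ _ f 0 e0 t (partial 0 f (t *: e0)).
  rewrite add0r => -[H _]; have := H _.
  rewrite (_ : (fun s => _) = (fun s : R => v `|s|)); last first.
    by apply/funext => s; rewrite add0r /f enorm_axis.
  apply; apply: (C2_on_partial fC2).
  by rewrite /eball/= enorm_axis ger0_norm.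
have p0 : partial 0 f 0 = 0.
  have := dline 0; rewrite lexx rho0 => /(_ isT); rewrite scale0r => /is_derive_cvgP h.
  apply/eqP; rewrite -normr_le0 leNgt; apply/negP => pp.
  set p := partial 0 f 0 in h pp *.
  (* Two approximations of v(s) - v(0), by p s and by 0, with error |p| s / 3 each, are
     incompatible. *)
  have p3 : 0 < `|p| / 3 by rewrite divr_gt0.
  have [d d0 dP] := h _ p3.
  move: v0 => /cvgrPdist_le/(_ _ p3)/nbhs_normP[d1 /= d10 d1P].
  pose m := Num.min d d1; have m0 : 0 < m by rewrite lt_min d0.
  pose s := m / 2; have s0 : 0 < s by rewrite divr_gt0.
  have : s < m by rewrite /s; lra.
  rewrite lt_min => /andP[sd sd1].
  have sn : `|s| = s by rewrite gtr0_norm.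
  have := dP s; rewrite sn sd => /(_ isT).
  rewrite [_ *: _]mulr1 addr0 sn normr0 => H1.
  have := d1P s; rewrite /ball_/= sub0r normrN sn => /(_ sd1 s0).
  rewrite sub0r normrN normrM normfV sn mulrC ler_pdivrMr// => H2.
  have : `|p * s| <= `|p| / 3 * s + `|p| / 3 * s.
    rewrite -[p * s](subrK (v s - v 0)) -opprB.
    apply: le_trans (ler_normD _ _) _; rewrite normrN lerD//.
  rewrite normrM sn; nra.
have [_ /(_ 0)[_ pc _]] := fC2 0 O0.
move=> e ee.
have /near_normP[d d0 dP] : \forall y \near (0 : 'rV[R]_K.+1),
    `|partial 0 f 0 - partial 0 f y| <= e.
  by move: pc => /cvgrPdist_le/(_ e ee).
have n1 : 0 < `|e0| + 1 by rewrite ltr_wpDl.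
exists (Num.min rho (d / (`|e0| + 1))); first by rewrite lt_min rho0 divr_gt0.
move=> s /andP[s0]; rewrite lt_min ltr_pdivlMr// => /andP[sr sd].
have dvs : is_derive s 1 v (partial 0 f (s *: e0)).
  apply: near_eq_is_derive (dline s _); last by rewrite ltW.
  apply/near_normP; exists s => // t; rewrite ltr_norml => /andP[t1 t2].
  by rewrite gtr0_norm//; lra.
rewrite derive1E (@derive_val _ _ _ _ _ _ _ dvs).
have := dP (s *: e0); rewrite p0 sub0r normrN subr0; apply.
rewrite normrZ gtr0_norm//; apply: le_lt_trans sd.
by rewrite ler_wpM2l ?lerDl// ltW.
Qed.

End RadialProfile.

(** * Comparison *)

Section RadialSolution.
Variables (R : realType) (n k : nat) (rho mu : R) (v : R -> R).
Hypotheses (kn : (0 < k <= n)%N) (rho0 : 0 < rho).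
Hypothesis v_cont : forall r0 e : R, 0 <= r0 <= rho -> 0 < e ->
  exists2 d : R, 0 < d & forall r : R, 0 <= r <= rho -> `|r - r0| < d -> `|v r - v r0| <= e.
Hypothesis v_below : forall r0 eta : R, 0 <= r0 < rho -> 0 < eta ->
  exists b c, - mu * v r0 - eta <= 2 * b * k%:R + 8 * c * r0 ^+ 2 /\
  exists2 d : R, 0 < d & forall r, 0 <= r -> `|r - r0| < d ->
    v r0 + b * (r ^+ 2 - r0 ^+ 2) + c * (r ^+ 2 - r0 ^+ 2) ^+ 2 <= v r.

Let u (x : 'rV[R]_n) := v (enorm x).

Lemma near_enorm (x : 'rV[R]_n) (d : R) : 0 < d -> \forall y \near x, `|enorm y - enorm x| < d.
Proof.
move=> d0; have /cvgrPdist_lt/(_ d d0) := @enorm_continuous R n x.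
by apply: filterS => y; rewrite distrC.
Qed.

Lemma radial_within_ball : {within eball rho, continuous u}.
Proof.
apply: continuous_subspaceW (radial_within v_cont).
by move=> x /ltW.
Qed.

(** [psi] touches u from above and the quartic [Q] touches it from below, so Q - psi has a local
    maximum at x and the Hessian of [Q] bounds that of [psi] from below. *)
Lemma radial_subsolution : viscosity_subsolution (Pplus k) mu (eball rho) u.
Proof.
split; first exact/within_usc_in/radial_within_ball.
move=> psi x psiC2 Ox uP; rewrite leNgt; apply/negP => neg.
(* Half of the supposed defect, so that the loss [eta] of the quartic cannot make up for it. *)
pose eta := - (Pplus k (hessian psi x) + mu * u x) / 2.
have eta0 : 0 < eta by rewrite /eta divr_gt0// oppr_gt0.
have [|b [c [bc [d d0 dP]]]] := @v_below (enorm x) eta _ eta0.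
  by rewrite enorm_ge0.
pose Q := @radial_quartic R n (u x) b c (dot x x).
have Qx : Q x = u x by apply: radial_quartic_at.
have uQ : \forall y \near x, Q y - psi y <= Q x - psi x.
  apply: filterS2 uP (near_enorm x d0) => y h1 /(dP _ (enorm_ge0 y)).
  rewrite !sqr_enorm Qx -/(u y) -/(u x) -/(radial_quartic _ _ _ _ _) -/(Q y); lra.
have : k%:R * (2 * b) + 8 * c * dot x x <= Pplus k (hessian psi x).
  apply: Pplus_ge kn _ => [|e e1]; first exact: (hessian_sym (@eball_open R n rho) psiC2 Ox).
  rewrite -(radial_quartic_hessian (u x) b c (erefl (dot x x)) e1).
  apply: second_order_comparison (@eball_open R n rho) _ psiC2 Ox uQ.
  exact: radial_quartic_C2.
move: bc; rewrite sqr_enorm -/(u x) /eta; lra.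
Qed.

(** The mirror argument with a quartic above u; its nonnegative [c] is what [Pplus_le] asks for. *)
Lemma radial_supersolution :
  (forall r0 eta : R, 0 <= r0 < rho -> 0 < eta ->
  exists b c, [/\ 0 <= c, 2 * b * k%:R + 8 * c * r0 ^+ 2 <= - mu * v r0 + eta &
  exists2 d : R, 0 < d & forall r, 0 <= r -> `|r - r0| < d ->
    v r <= v r0 + b * (r ^+ 2 - r0 ^+ 2) + c * (r ^+ 2 - r0 ^+ 2) ^+ 2]) ->
  viscosity_supersolution (Pplus k) mu (eball rho) u.
Proof.
move=> v_above; split; first exact/within_lsc_in/radial_within_ball.
move=> psi x psiC2 Ox uP; rewrite leNgt; apply/negP => neg.
pose eta := (Pplus k (hessian psi x) + mu * u x) / 2.
have eta0 : 0 < eta by rewrite /eta divr_gt0.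
have [|b [c [c0 bc [d d0 dP]]]] := v_above (enorm x) eta _ eta0.
  by rewrite enorm_ge0.
pose Q := @radial_quartic R n (u x) b c (dot x x).
have Qx : Q x = u x by apply: radial_quartic_at.
have uQ : \forall y \near x, psi y - Q y <= psi x - Q x.
  apply: filterS2 uP (near_enorm x d0) => y h1 /(dP _ (enorm_ge0 y)).
  rewrite !sqr_enorm Qx -/(u y) -/(u x) -/(radial_quartic _ _ _ _ _) -/(Q y); lra.
have : Pplus k (hessian psi x) <= k%:R * (2 * b) + 8 * c * dot x x.
  apply: Pplus_le; first exact: (hessian_sym (@eball_open R n rho) psiC2 Ox).
  - by case/andP: kn.
  - by rewrite mulr_ge0.
  move=> e e1; rewrite -(radial_quartic_hessian (u x) b c (erefl (dot x x)) e1).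
  apply: second_order_comparison (@eball_open R n rho) psiC2 _ Ox uQ.
  exact: radial_quartic_C2.
move: bc; rewrite sqr_enorm -/(u x) /eta; lra.
Qed.

Hypotheses (v_gt0 : forall r : R, 0 <= r -> r < rho -> 0 < v r) (v_rho : v rho = 0).

(* For s > 1 the function v(s|x|) has eigenvalue s^2 mu on a ball strictly
   inside the domain; at a maximum point of its quotient by phi it touches a
   multiple of phi from below. *)
Lemma supersolution_bound (phi : 'rV[R]_n -> R) (m : R) : 0 < mu ->
  positive_in (eball rho) phi ->
  viscosity_supersolution (Pplus k) m (eball rho) phi -> m <= mu.
Proof.
move=> mu0 phi0 [lphi sphi]; rewrite leNgt; apply/negP => mum.
(* s^2 is the midpoint of 1 and m / mu, hence s > 1 and s^2 mu = (m + mu) / 2 < m. *)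
pose s := Num.sqrt ((m / mu + 1) / 2).
have q1 : 1 < m / mu by rewrite ltr_pdivlMr// mul1r.
have s2 : s ^+ 2 = (m / mu + 1) / 2 by rewrite sqr_sqrtr//; lra.
have s0 : 0 < s by rewrite sqrtr_gt0; lra.
have s1 : 1 < s.
  rewrite -(@ltr_pXn2r _ 2)// ?nnegrE ?ltW// expr1n s2; lra.
have sm : s ^+ 2 * mu < m.
  by rewrite s2 -ltr_pdivlMr//; lra.
pose K := [set x : 'rV[R]_n | enorm x <= rho / s].
have KO x : K x -> eball rho x.
  move=> xK; apply: (le_lt_trans xK).
  by rewrite ltr_pdivrMr// ltr_pMr.
have Ks x : K x -> 0 <= s * enorm x <= rho.
  rewrite /K/= ler_pdivlMr// mulrC => ->.
  by rewrite mulr_ge0 ?enorm_ge0// ltW.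
pose W (x : 'rV[R]_n) := v (s * enorm x).
have W0 x : K x -> 0 <= W x.
  move=> /Ks /andP[sx]; rewrite le_eqVlt => /predU1P[E|h].
    by rewrite /W E v_rho.
  by rewrite ltW// v_gt0.
have K0 : K 0 by rewrite /K/= enormE dot0l sqrtr0 divr_ge0// ltW.
(* [phi] is only lower semicontinuous, so W / phi is upper semicontinuous and its maximum is found
   as a minimum of the opposite function. *)
have [||c Kc cmin] := @compact_min _ _ K (fun x => - (W x / phi x)) (@cball_compact R n (rho / s)).
- by exists 0.
- move=> x a Kx aW.
  have px : 0 < phi x by exact/phi0/KO.
  have a0 : 0 < - a.
    by rewrite oppr_gt0; apply: lt_le_trans aW _; rewrite oppr_le0 divr_ge0// ?W0// ltW.
  (* One half of [gap] is left for the variation of [W], the other for a possible drop of [phi],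
     scaled by -a. *)
  pose gap := - a * phi x - W x.
  have gap0 : 0 < gap.
    by rewrite /gap subr_gt0 -ltr_pdivrMr// ltrNr.
  have g2 : 0 < gap / 2 by rewrite divr_gt0.
  have [d d0 dP] := v_cont (Ks _ Kx) g2.
  have p1 : \forall y \near x, phi x - gap / 2 / - a < phi y.
    apply: (lsc_in_near (@eball_open R n rho) lphi (KO _ Kx)).
    by rewrite gtrBl divr_gt0.
  have ds : 0 < d / s by rewrite divr_gt0.
  near=> y => Ky.
  have py : 0 < phi y by exact/phi0/KO.
  rewrite ltrNr ltr_pdivrMr//.
  have y1 : phi x - gap / 2 / - a < phi y by near: y.
  have y2 : `|enorm y - enorm x| < d / s by near: y; exact: near_enorm.
  have : `|W y - W x| <= gap / 2.
    apply: dP; first exact: Ks.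
    by rewrite -mulrBr normrM gtr0_norm// mulrC -ltr_pdivlMr.
  rewrite ler_norml => /andP[_ h].
  have : - a * (phi x - gap / 2 / - a) < - a * phi y by rewrite ltr_pM2l.
  rewrite mulrBr [- a * (gap / 2 / - a)]mulrC divfK ?gt_eqF//.
  rewrite /gap in h *; lra.
have Oc := KO _ Kc.
have pc : 0 < phi c by exact: phi0.
have p0 : 0 < phi 0 by exact/phi0/KO.
pose M := W c / phi c.
have Mmax x : K x -> W x <= M * phi x.
  move=> Kx; have px : 0 < phi x by exact/phi0/KO.
  by have := cmin x Kx; rewrite lerN2 ler_pdivrMr.
have W00 : 0 < W 0 by rewrite /W enormE dot0l sqrtr0 mulr0 v_gt0.
have M0 : 0 < M.
  by have := Mmax _ K0; move=> /(lt_le_trans W00); rewrite pmulr_lgt0.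
have WcE : W c = M * phi c by rewrite /M divfK// gt_eqF.
have Wc : 0 < W c by rewrite WcE mulr_gt0.
(* The maximum is positive while [W] vanishes where |x| = rho / s, so c is interior to [K] and the
   quartic bound applies at s |c|. *)
have cr : 0 <= s * enorm c < rho.
  have /andP[-> ] := Ks _ Kc; rewrite le_eqVlt => /predU1P[E|->//].
  by move: Wc; rewrite /W E v_rho !ltxx.
(* After multiplication by s^2, [eta] costs half of (m - s^2 mu) W(c); the other half yields the
   contradiction. *)
pose eta := (m - s ^+ 2 * mu) * W c / (2 * s ^+ 2).
have ss : 0 < s ^+ 2 by rewrite exprn_gt0.
have eta0 : 0 < eta by rewrite /eta divr_gt0 ?mulr_gt0// subr_gt0.
have [b [a [ba [d d0 dP]]]] := v_below cr eta0.
(* The quartic below v at s |c|, in the variable s |y| and divided by M: the factor s^2 goes with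
   |y|^2. Then M Q <= W <= M phi near c, with equality at c. *)
pose Q := @radial_quartic R n (phi c) (b * s ^+ 2 / M) (a * s ^+ 4 / M) (dot c c).
have Qc : Q c = phi c by apply: radial_quartic_at.
have touch : \forall y \near c, phi c - Q c <= phi y - Q y.
  have Kn : enorm c < rho / s by rewrite ltr_pdivlMr// mulrC; case/andP: cr.
  have ds : 0 < d / s by rewrite divr_gt0.
  near=> y.
  have y1 : `|enorm y - enorm c| < d / s by near: y; exact: near_enorm.
  have Ky : K y.
    apply: ltW; near: y; exact: (@near_open R n (eball (rho / s)) (@eball_open R n _) c Kn).
  have /andP[sy0 _] := Ks _ Ky; have := dP _ sy0.
  rewrite -mulrBr normrM gtr0_norm// mulrC -ltr_pdivlMr// => /(_ y1).
  rewrite !exprMn !sqr_enorm -/(W c) -/(W y) => h.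
  rewrite Qc subrr subr_ge0.
  rewrite -(ler_pM2l M0); apply: le_trans (Mmax _ Ky); apply: le_trans h.
  rewrite le_eqVlt; apply/orP; left; apply/eqP.
  by rewrite WcE /Q /radial_quartic; field; rewrite gt_eqF.
have QC2 : C2_on (eball rho) Q by exact: radial_quartic_C2.
have := sphi Q c QC2 Oc touch.
have H : k%:R * (2 * (b * s ^+ 2 / M)) + 8 * (a * s ^+ 4 / M) * dot c c <= Pplus k (hessian Q c).
  apply: Pplus_ge => //; first exact: (hessian_sym (@eball_open R n rho) QC2 Oc).
  by move=> e e1; rewrite radial_quartic_hessian.
have HE : k%:R * (2 * (b * s ^+ 2 / M)) + 8 * (a * s ^+ 4 / M) * dot c c =
    s ^+ 2 / M * (2 * b * k%:R + 8 * a * (s * enorm c) ^+ 2).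
  by rewrite exprMn sqr_enorm; ring.
have : s ^+ 2 / M * (- mu * W c - eta) <= Pplus k (hessian Q c).
  by apply: le_trans H; rewrite HE ler_wpM2l// divr_ge0// ltW.
have -> : phi c = W c / M by rewrite WcE mulrC mulKf// gt_eqF.
have -> : s ^+ 2 / M * (- mu * W c - eta) =
    (- (s ^+ 2 * mu) * W c - (m - s ^+ 2 * mu) * W c / 2) / M.
  by rewrite /eta; field; rewrite !gt_eqF.
move=> h1 h2.
have : ((m - s ^+ 2 * mu) * W c / 2) / M <= 0.
  apply: le_trans h2; rewrite -lerBlDr; apply: le_trans h1.
  by rewrite le_eqVlt; apply/orP; left; apply/eqP; field; rewrite gt_eqF.
by rewrite leNgt divr_gt0// divr_gt0// mulr_gt0// subr_gt0.
Unshelve. all: by end_near. Qed.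

End RadialSolution.

Theorem mainTheorem8 (R : realType) (N k : nat) (rho muD : R) (v : R -> R)
  (hN : (2 <= N)%N) (hk : (1 <= k <= N - 1)%N) (hrho : 0 < rho)
  (hmuD : laplace_principal_eigenvalue (@eball R k rho) muD)
  (hv : laplace_principal_eigenfunction (@eball R k rho) muD
          (fun x => v (enorm x)))
  (v_gt0 : forall r : R, 0 <= r -> r < rho -> 0 < v r)
  (v_ode : forall r : R, 0 < r -> r < rho ->
     [/\ derivable v r 1, derivable v^`()%classic r 1 &
         v^`(2)%classic r + (k%:R - 1) / r * v^`()%classic r + muD * v r = 0])
  (v_dif0 : h^-1 * (v h - v 0) @[h --> 0^'+] --> (0 : R))
  (v_rho : v rho = 0) :
  mu_plus k (@eball R N rho) = muD%:E /\
  let u := fun x : 'rV[R]_N => v (enorm x) in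
  [/\ positive_in (eball rho) u,
      vanishes_on_boundary (eball rho) u &
      viscosity_solution (Pplus k) (fine (mu_plus k (@eball R N rho)))
        (eball rho) u].
Proof.
case: k hk hmuD hv v_ode => [|K] // hk _ [vC2 _ [vc _] _] v_ode.
have kN : (0 < K.+1 <= N)%N by lia.
have v_cont := profile_continuous hrho vc.
have dv (r : R) : 0 < r < rho -> is_derive r 1 v (v^`()%classic r).
  by move=> /andP[r0 rr]; have [d1 _ _] := v_ode r r0 rr; rewrite derive1E; exact: derivableP.
have dv1 (r : R) : 0 < r < rho -> is_derive r 1 v^`()%classic (v^`(2)%classic r).
  move=> /andP[r0 rr]; have [_ d2 _] := v_ode r r0 rr.
  by rewrite derive1nS derive1n1 derive1E; exact: derivableP.
have ode (r : R) : 0 < r < rho ->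
    v^`(2)%classic r + K%:R / r * v^`()%classic r + muD * v r = 0.
  move=> /andP[r0 rr]; have [_ _] := v_ode r r0 rr.
  by rewrite -natr1 addrK.
have v1_0 : small_at_right0 v^`()%classic.
  apply: profile_derivative_small vC2 _ v_dif0 => // r /andP[r0 rr].
  by have [] := v_ode r r0 rr.
have mu0 : 0 < muD by apply: (@eigenvalue_gt0 R K rho muD v v^`()%classic v^`(2)%classic).
have below := @radial_quartic_below R K rho muD v v^`()%classic v^`(2)%classic.
have above := @radial_quartic_above R K rho muD v v^`()%classic v^`(2)%classic.
have {}below := below hrho v_cont dv dv1 ode v1_0.
have {}above := above hrho v_gt0 v_cont v_rho dv dv1 ode v1_0.
have sub := radial_subsolution kN v_cont below.
have super := radial_supersolution kN v_cont above.
have pos : positive_in (eball rho) (fun x : 'rV[R]_N => v (enorm x)).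
  by move=> x xr; apply: v_gt0 => //; exact: enorm_ge0.
have muE : mu_plus K.+1 (@eball R N rho) = muD%:E.
  apply/eqP; rewrite eq_le; apply/andP; split.
    apply: ge_ereal_sup => _ [m [phi [phi0 sphi]] <-]; rewrite lee_fin.
    exact: (supersolution_bound kN hrho v_cont below v_gt0 v_rho mu0 phi0 sphi).
  (* The supremum is attained: u itself is an admissible positive supersolution for [muD]. *)
  by apply: ereal_sup_ubound; exists muD => //; exists (fun x => v (enorm x)).
split => //; rewrite muE; split => //; split.
  by apply/(within_closed_ball _ hrho); exact: radial_within.
by move=> x /boundary_eball ->.
Qed.
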